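(* Let $n\in\mathbb{N}$ (so $n\ge1$), $0<p<\infty$ and $\alpha>np-1$. (i) If $f=u+iv$ is a harmonic $K$-quasiregular function in $\mathbb{D}$ (for some $K\ge1$), with real part $u$ and imaginary part $v$, and $u\in Q_h(n,p,\alpha)$, then $v\in Q_h(n,p,\alpha)$. (ii) If $f=u+iv$ is analytic in $\mathbb{D}$, with real part $u$ and imaginary part $v$, and $u\in Q_h(n,p,\alpha)$, then $v\in Q_h(n,p,\alpha)$.
   Context: $\mathbb{D}=\{z\in\mathbb{C}:|z|<1\}$, $dA(z)=\frac1\pi\,dx\,dy$, and for $a\in\mathbb{D}$, $\sigma_a(z)=\frac{a-z}{1-\overline a z}$. Every complex-valued harmonic function on $\mathbb{D}$ is uniquely of the form $f=h+\overline g$ with $h,g$ analytic in $\mathbb{D}$ and $g(0)=0$. For $0<p<\infty$, $\alpha>-1$, $n\in\mathbb{N}$, a harmonic function $f=h+\overline g$ belongs to $Q_h(n,p,\alpha)$ if $$\|f\|_{Q_h(n,p,\alpha)}^p=\sup_{a\in\mathbb{D}}\int_{\mathbb{D}}\left(|(h\circ\sigma_a)^{(n)}(z)|+|(g\circ\sigma_a)^{(n)}(z)|\right)^p(1-|z|^2)^\alpha\,dA(z)<\infty.$$ Real-valued harmonic functions are regarded as complex-valued harmonic functions. A harmonic function $f=h+\overline g$ is sense-preserving if $|g'(z)|<|h'(z)|$ for all $z\in\mathbb{D}$; a sense-preserving harmonic $f$ is $K$-quasiregular, $K\ge1$, if $|g'(z)|\le k|h'(z)|$ for all $z\in\mathbb{D}$,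 where $k=\frac{K-1}{K+1}<1$. *)

(* Defs.v *)
From mathcomp Require Import all_boot all_order all_algebra.
From mathcomp Require Import complex.
From mathcomp Require Import all_classical all_reals all_analysis.

Set Implicit Arguments.
Unset Strict Implicit.
Unset Printing Implicit Defensive.

Import Order.TTheory GRing.Theory Num.Theory.
Import numFieldNormedType.Exports.

Local Open Scope complex_scope.
Local Open Scope ring_scope.
Local Open Scope classical_set_scope.

Section Disk.
Variable R : realType.
Local Notation C := R[i].
Implicit Types (f h g : C -> C^o) (w : R * R -> R).

(* The norm of [R[i]] takes its values in [R[i]]; this is the modulus in [R]. *)
Definition cabs (z : C) : R := complex.Re `|z|.

Definition disk : set C := [set z | cabs z < 1].

Definition of_plane (xy : R * R) : C := xy.1 +i* xy.2.

Definition plane_disk : set (R * R) := of_plane @^-1` disk.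

(* [C^o] is [C] as a normed space over itself: with this codomain,
   [derivable _ z 1], [_^`()] and [_^`(n)] are complex differentiability and
   complex derivatives. *)
Definition analytic f : Prop := forall z, disk z -> derivable (f : C^o -> C^o) z 1.

Definition e_x : R * R := (1, 0).
Definition e_y : R * R := (0, 1).

Definition C1_disk w : Prop := forall xy, plane_disk xy ->
  [/\ {for xy, continuous w},
      derivable w xy e_x, derivable w xy e_y,
      {for xy, continuous ('D_e_x w)} & {for xy, continuous ('D_e_y w)}].

Definition C2_disk w : Prop :=
  [/\ C1_disk w, C1_disk ('D_e_x w) & C1_disk ('D_e_y w)].

Definition laplacian w (xy : R * R) : R :=
  'D_e_x ('D_e_x w) xy + 'D_e_y ('D_e_y w) xy.

Definition real_harmonic w : Prop :=
  C2_disk w /\ forall xy, plane_disk xy -> laplacian w xy = 0.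

Definition harmonic_fun f : Prop :=
  real_harmonic (fun xy => complex.Re (f (of_plane xy))) /\
  real_harmonic (fun xy => complex.Im (f (of_plane xy))).

(* [h] and [g] are determined on the disk by [f]. *)
Definition canonical_decomposition f h g : Prop :=
  [/\ analytic h, analytic g, g 0 = 0 &
      forall z, disk z -> f z = h z + (g z)^*].

Definition sigma (a z : C) : C := (a - z) / (1 - a^* * z).

(* The normalized area measure is dA = dx dy / pi. *)
Definition area_integral (F : C -> R) : \bar R :=
  ((pi^-1)%:E * \int[(lebesgue_measure \x lebesgue_measure)%E]_(xy in plane_disk)
     (F (of_plane xy))%:E)%E.

(* The p-th power of the norm of h + conj g. *)
Definition Qh_norm_pow (n : nat) (p alpha : R) h g : \bar R :=
  ereal_sup [set area_integral (fun z =>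
      (cabs ((h \o sigma a)^`(n) z) + cabs ((g \o sigma a)^`(n) z)) `^ p
        * (1 - cabs z ^+ 2) `^ alpha) | a in disk].

Definition Qh (n : nat) (p alpha : R) f : Prop :=
  harmonic_fun f /\
  exists h g, canonical_decomposition f h g /\
              (Qh_norm_pow n p alpha h g < +oo)%E.

Definition sense_preserving h g : Prop :=
  forall z, disk z -> cabs (g^`() z) < cabs (h^`() z).

Definition quasiregular (K : R) f : Prop :=
  harmonic_fun f /\
  exists h g, [/\ canonical_decomposition f h g, sense_preserving h g &
    forall z, disk z ->
      cabs (g^`() z) <= (K - 1) / (K + 1) * cabs (h^`() z)].

Definition re_part f : C -> C^o := fun z => (complex.Re (f z))%:C.
Definition im_part f : C -> C^o := fun z => (complex.Im (f z))%:C.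

End Disk.

(* Main.v *)
Require Import Defs.
From mathcomp Require Import all_boot all_order all_algebra.
From mathcomp Require Import complex.
From mathcomp Require Import all_classical all_reals all_analysis.
From mathcomp Require Import measurable_realfun ring lra.

(** Since [alpha > n p - 1], finiteness of the [Q_h(n, p, alpha)] norm of
   [h + conj g] amounts to [h] and [g] being Bloch functions, that is, to
   [(1 - |a|^2) |h'(a)|] and [(1 - |a|^2) |g'(a)|] being bounded.  The Bloch
   condition involves first derivatives only, and for these the real and the
   imaginary part can be compared point by point.  If [f = h + conj g], then
   [Re f = H + conj G] with [H' = G' = (h' + g') / 2], while [Im f = q + conj q]
   with [q' = (h' - g') / (2 i)]; quasiregularity, [|g'| <= k |h'|], gives
   [|q'| <= (1 + k) / (1 - k) |H'| = K |H'|] (lemma [dilatation_le]).  When [f] is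
   analytic, [g = 0] and [|q'| = |H'|].  So the Bloch condition passes from [H] to
   [q], and lemma [Qh_im_part] concludes.

   From the norm to the Bloch condition ([bloch_of_Qh]).  Bounded area means of
   [|F|^p (1 - |z|^2)^alpha] bound [|F 0|] uniformly over holomorphic [F]
   ([value0_le_of_area_integral]): near a point where [(1/2 - |z|)^(2/p) |F z|] is
   almost maximal, Cauchy's estimate keeps [|F|] large on a disc of comparable
   radius.  With [F] the [n]th derivative of [H o sigma_a], this bounds these
   derivatives at the origin for all [a].  Then [bloch_of_derivn] recovers the
   first derivative: averaging [e^(-it) G (e^(it) sigma_s w)], [G = H o sigma_a],
   over [t] leaves [G' 0 * sigma_s w], and its [n]th derivative at [w = 0] is
   [G' 0] times a nonzero number, whereas each averaged function is, up to
   rotations, one of the [H o sigma_c].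

   From the Bloch condition to the norm ([Qh_of_bloch]).  The Bloch condition is
   invariant under automorphisms, and Cauchy's estimate yields
   [(1 - |z|)^n |(q o sigma_a)^(n) z| <= C] uniformly in [a].  The integrand is
   then at most a multiple of [(1 - |z|^2)^(alpha - n p)], whose exponent is
   greater than [-1] ([disk_weight_integral]).

   The analytic parts of a harmonic function have continuous first derivatives,
   because these are Wirtinger derivatives of a twice continuously differentiable
   function ([hol_of_C1_decomposition]).  For such functions the mean value
   property over circles follows by differentiation in the radius
   ([circle_mean]); differentiating it in the centre and integrating by parts
   ([circle_moment]) expresses [F'] through the values of [F], which yields
   Cauchy's estimate and, by iteration, all higher derivatives ([holo_deriv]). *)

Import Order.TTheory GRing.Theory Num.Theory.
Import numFieldNormedType.Exports.
Local Open Scope ring_scope.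
Local Open Scope classical_set_scope.

Set Implicit Arguments.
Unset Strict Implicit.
Unset Printing Implicit Defensive.

(** * Modulus of a complex number *)

Section Modulus.
Context {R : realType}.
Local Notation C := R[i].
Local Notation rc := (real_complex R).
Implicit Types z w : C.

Lemma le_of_eq (x y : R) : x = y -> x <= y. Proof. by move=> ->. Qed.

Lemma cabsE z : cabs z = Normc.normc z. Proof. by case: z. Qed.

Lemma normC_cabs z : `|z| = rc (cabs z).
Proof. by rewrite cabsE; case: z. Qed.

Lemma cabs_sqrt z : cabs z = Num.sqrt (complex.Re z ^+ 2 + complex.Im z ^+ 2).
Proof. by rewrite cabsE; case: z. Qed.

Lemma cabs_ge0 z : 0 <= cabs z. Proof. by rewrite cabs_sqrt sqrtr_ge0. Qed.

Lemma cabs_sqr z : cabs z ^+ 2 = complex.Re z ^+ 2 + complex.Im z ^+ 2.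
Proof. by rewrite cabs_sqrt sqr_sqrtr// addr_ge0// sqr_ge0. Qed.

Lemma cabs0 : cabs (0 : C) = 0. Proof. by rewrite cabsE Normc.normc0. Qed.

Lemma cabs1 : cabs (1 : C) = 1. Proof. by rewrite cabsE Normc.normc1. Qed.

Lemma cabsM z w : cabs (z * w) = cabs z * cabs w.
Proof. by rewrite !cabsE Normc.normcM. Qed.

Lemma cabsV z : cabs z^-1 = (cabs z)^-1.
Proof. by rewrite !cabsE Normc.normcV. Qed.

Lemma cabsD z w : cabs (z + w) <= cabs z + cabs w.
Proof. by rewrite -lecR rmorphD/= -!normC_cabs ler_normD. Qed.

Lemma cabsN z : cabs (- z) = cabs z.
Proof. by apply: complexI; rewrite -!normC_cabs normrN. Qed.

Lemma cabsB z w : cabs (z - w) = cabs (w - z).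
Proof. by rewrite -cabsN opprB. Qed.

Lemma cabsX z n : cabs (z ^+ n) = cabs z ^+ n.
Proof. by elim: n => [|n IH]; rewrite ?expr0 ?cabs1// !exprS cabsM IH. Qed.

Lemma cabs_eq0 z : (cabs z == 0) = (z == 0).
Proof.
apply/idP/idP => [/eqP|/eqP->]; last by rewrite cabs0.
by rewrite cabsE => /Normc.eq0_normc ->.
Qed.

Lemma cabs_gt0 z : (0 < cabs z) = (z != 0).
Proof. by rewrite lt_def cabs_eq0 cabs_ge0 andbT. Qed.

Lemma cabs_rc (x : R) : cabs (rc x) = `|x|.
Proof. by rewrite cabs_sqrt/= expr0n/= addr0 sqrtr_sqr. Qed.

Lemma cabs_conj z : cabs (conjc z) = cabs z.
Proof. by rewrite !cabs_sqrt; case: z => a b /=; rewrite sqrrN. Qed.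

Lemma cabs_Re z : `|complex.Re z| <= cabs z.
Proof.
by rewrite cabs_sqrt -sqrtr_sqr ler_sqrt ?addr_ge0 ?sqr_ge0// lerDl sqr_ge0.
Qed.

Lemma cabs_Im z : `|complex.Im z| <= cabs z.
Proof.
by rewrite cabs_sqrt -sqrtr_sqr ler_sqrt ?addr_ge0 ?sqr_ge0// lerDr sqr_ge0.
Qed.

Lemma cabs_le_ReIm z : cabs z <= `|complex.Re z| + `|complex.Im z|.
Proof.
rewrite cabs_sqrt -[leRHS]ger0_norm ?addr_ge0// -sqrtr_sqr ler_sqrt ?sqr_ge0//.
rewrite sqrrD !real_normK ?num_real// addrAC lerDl mulrn_wge0//.
Qed.

Lemma conj_mul z : conjc z * z = rc (cabs z ^+ 2).
Proof.
rewrite cabs_sqr; case: z => a b; apply/eqP; rewrite eq_complex/=.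
by apply/andP; split; apply/eqP; ring.
Qed.

Lemma ReM_rc (x : R) z : complex.Re (rc x * z) = x * complex.Re z.
Proof. by case: z => a b /=; ring. Qed.

Lemma ReD z w : complex.Re (z + w) = complex.Re z + complex.Re w.
Proof. by case: z w => ? ? [? ?]. Qed.

Lemma ImD z w : complex.Im (z + w) = complex.Im z + complex.Im w.
Proof. by case: z w => ? ? [? ?]. Qed.

Lemma ReN z : complex.Re (- z) = - complex.Re z. Proof. by case: z. Qed.

Lemma ImN z : complex.Im (- z) = - complex.Im z. Proof. by case: z. Qed.

End Modulus.

(** * Derivatives along the real or the complex line *)

Section Derivatives.
Context {R : realType}.
Local Notation C := R[i].
Local Notation rc := (real_complex R).

(** The variable runs over a ring [K] embedded in the complex numbers, so that
   the same rules serve for curves ([K] the reals) and for holomorphic functions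
   ([K] the complex numbers). *)
Definition hderiv (K : pzRingType) (j : K -> C) (P : K -> C) (t : K) (l : C) :=
  forall e : R, 0 < e -> exists2 d : R, 0 < d & forall h, cabs (j h) <= d ->
    cabs (P (t + h) - P t - j h * l) <= e * cabs (j h).

Definition hcont (K : pzRingType) (j : K -> C) (P : K -> C) (t : K) :=
  forall e : R, 0 < e -> exists2 d : R, 0 < d & forall h, cabs (j h) <= d ->
    cabs (P (t + h) - P t) <= e.

Definition cderiv := @hderiv C idfun.
Definition rderiv := @hderiv R rc.
Definition ccont := @hcont C idfun.
Definition rcont := @hcont R rc.

Section Generic.
Variables (K : pzRingType) (j : {rmorphism K -> C}).
Implicit Types (P Q : K -> C) (t : K) (l m : C).

Lemma hderiv_near P Q t l r : 0 < r ->
  (forall h, cabs (j h) <= r -> P (t + h) = Q (t + h)) ->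
  hderiv j P t l -> hderiv j Q t l.
Proof.
move=> r0 PQ dP e e0; have [d d0 Hd] := dP e e0.
exists (Num.min d r); first by rewrite lt_min d0.
move=> h; rewrite le_min => /andP[hd hr].
have := PQ 0; rewrite addr0 rmorph0 cabs0 => /(_ (ltW r0)) <-.
by rewrite -PQ// Hd.
Qed.

Lemma hcont_near P Q t r : 0 < r ->
  (forall h, cabs (j h) <= r -> P (t + h) = Q (t + h)) ->
  hcont j P t -> hcont j Q t.
Proof.
move=> r0 PQ dP e e0; have [d d0 Hd] := dP e e0.
exists (Num.min d r); first by rewrite lt_min d0.
move=> h; rewrite le_min => /andP[hd hr].
have := PQ 0; rewrite addr0 rmorph0 cabs0 => /(_ (ltW r0)) <-.
by rewrite -PQ// Hd.
Qed.

Lemma hderiv_lip P t l : hderiv j P t l ->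
  exists2 d, 0 < d & forall h, cabs (j h) <= d ->
    cabs (P (t + h) - P t) <= (cabs l + 1) * cabs (j h).
Proof.
move=> /(_ 1 ltr01)[d d0 Hd]; exists d => // h /Hd; rewrite mul1r => H.
rewrite -[X in cabs X](subrK (j h * l)) (le_trans (cabsD _ _))//.
by rewrite cabsM mulrDl mul1r [cabs l * _]mulrC addrC lerD2l.
Qed.

Lemma hderiv_cont P t l : hderiv j P t l -> hcont j P t.
Proof.
move=> /hderiv_lip[d d0 Hd] e e0.
have l0 : 0 < cabs l + 1 by rewrite ltr_wpDl// cabs_ge0.
exists (Num.min d (e / (cabs l + 1))); first by rewrite lt_min d0 divr_gt0.
move=> h; rewrite le_min => /andP[/Hd H]; rewrite ler_pdivlMr// mulrC => ?.
exact: le_trans H _.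
Qed.

Lemma hderiv_cst (c : C) t : hderiv j (fun=> c) t 0.
Proof.
move=> e e0; exists 1 => // h _.
by rewrite subrr mulr0 subr0 cabs0 mulr_ge0 ?cabs_ge0// ltW.
Qed.

Lemma hderiv_id t : hderiv j j t 1.
Proof.
move=> e e0; exists 1 => // h _.
rewrite rmorphD/= (_ : _ - _ = 0); first by rewrite cabs0 mulr_ge0 ?cabs_ge0// ltW.
by ring.
Qed.

Lemma hderivD P Q t l m : hderiv j P t l -> hderiv j Q t m ->
  hderiv j (fun x => P x + Q x) t (l + m).
Proof.
move=> dP dQ e e0; have e2 : 0 < e / 2 by rewrite divr_gt0.
have [d1 d10 H1] := dP _ e2; have [d2 d20 H2] := dQ _ e2.
exists (Num.min d1 d2); first by rewrite lt_min d10.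
move=> h; rewrite le_min => /andP[/H1 h1 /H2 h2].
have -> : P (t + h) + Q (t + h) - (P t + Q t) - j h * (l + m) =
  (P (t + h) - P t - j h * l) + (Q (t + h) - Q t - j h * m) by ring.
rewrite (le_trans (cabsD _ _))// (le_trans (lerD h1 h2))// -mulrDl.
by rewrite -splitr.
Qed.

Lemma hderivM P Q t l m : hderiv j P t l -> hderiv j Q t m ->
  hderiv j (fun x => P x * Q x) t (l * Q t + P t * m).
Proof.
move=> dP dQ e e0.
pose A := cabs (P t) + cabs (Q t) + cabs l + 1.
have A1 : 1 <= A by rewrite /A lerDr !addr_ge0 ?cabs_ge0.
have A0 : 0 < A by apply: lt_le_trans A1.
have e3 : 0 < e / (A * 3) by rewrite divr_gt0// mulr_gt0.
have [d1 d10 H1] := dP _ e3; have [d2 d20 H2] := dQ _ e3.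
have [d3 d30 H3] := hderiv_cont dQ e3.
have [d4 d40 H4] := hderiv_lip dP.
exists (Num.min (Num.min d1 d2) (Num.min d3 d4)); first by rewrite !lt_min d10 d20 d30.
move=> h; rewrite !le_min => /andP[/andP[/H1 h1 /H2 h2] /andP[/H3 h3 /H4 h4]].
have -> : P (t + h) * Q (t + h) - P t * Q t - j h * (l * Q t + P t * m) =
  (P (t + h) - P t - j h * l) * Q t + P t * (Q (t + h) - Q t - j h * m)
  + (P (t + h) - P t) * (Q (t + h) - Q t) by ring.
have PA : cabs (P t) <= A.
  by rewrite /A -!addrA lerDl !addr_ge0 ?cabs_ge0.
have QA : cabs (Q t) <= A.
  by rewrite /A [cabs (P t) + _]addrC -!addrA lerDl !addr_ge0 ?cabs_ge0.
have lA : cabs l + 1 <= A.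
  by rewrite /A -!addrA addrA lerDr !addr_ge0 ?cabs_ge0.
have E : e / (A * 3) * A = e / 3 by field; rewrite gt_eqF.
have j0 := cabs_ge0 (j h).
apply: (@le_trans _ _ (e / 3 * cabs (j h) + e / 3 * cabs (j h) + e / 3 * cabs (j h))); last first.
  by rewrite -!mulrDl; apply: ler_wpM2r => //; lra.
rewrite (le_trans (cabsD _ _))// lerD//.
  rewrite (le_trans (cabsD _ _))// !cabsM lerD//.
    by rewrite -E mulrAC ler_pM ?cabs_ge0.
  by rewrite -E mulrAC mulrC ler_pM ?cabs_ge0.
rewrite cabsM -E -mulrA mulrC ler_pM ?cabs_ge0//.
by rewrite (le_trans h4)// ler_wpM2r.
Qed.

Lemma hderivZ P (c : C) t l : hderiv j P t l ->
  hderiv j (fun x => c * P x) t (c * l).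
Proof. by move=> dP; have := hderivM (hderiv_cst c t) dP; rewrite mul0r add0r. Qed.

Lemma hderivN P t l : hderiv j P t l -> hderiv j (fun x => - P x) t (- l).
Proof.
move=> /(hderivZ (-1)); rewrite mulN1r.
by apply: (hderiv_near ltr01) => h _; rewrite mulN1r.
Qed.

Lemma hderivB P Q t l m : hderiv j P t l -> hderiv j Q t m ->
  hderiv j (fun x => P x - Q x) t (l - m).
Proof. by move=> dP /hderivN; exact: hderivD. Qed.

Lemma hderiv_comp (F : C -> C) P t l m : hderiv j P t l -> cderiv F (P t) m ->
  hderiv j (fun x => F (P x)) t (l * m).
Proof.
move=> dP dF e e0; have A0 : 0 < cabs l + 1 by rewrite ltr_wpDl ?cabs_ge0.
have B0 : 0 < cabs m + 1 by rewrite ltr_wpDl ?cabs_ge0.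
have e1 : 0 < e / 2 / (cabs l + 1) by rewrite !divr_gt0.
have e2 : 0 < e / 2 / (cabs m + 1) by rewrite !divr_gt0.
have [d1 d10 H1] := dF _ e1; have [d2 d20 H2] := dP _ e2.
have [d3 d30 H3] := hderiv_cont dP d10.
have [d4 d40 H4] := hderiv_lip dP.
exists (Num.min d2 (Num.min d3 d4)); first by rewrite !lt_min d20 d30.
move=> h; rewrite !le_min => /andP[/H2 h2 /andP[/H3 h3 /H4 h4]].
set k := P (t + h) - P t in h2 h3 h4.
have -> : F (P (t + h)) - F (P t) - j h * (l * m) =
   (F (P t + k) - F (P t) - k * m) + (k - j h * l) * m.
  by rewrite (_ : P t + k = P (t + h)) /k; ring.
rewrite (le_trans (cabsD _ _))// [e]splitr [leRHS]mulrDl lerD//.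
  rewrite (le_trans (H1 _ h3))//.
  apply: (le_trans (ler_wpM2l (ltW e1) h4)).
  by rewrite mulrA divfK ?gt_eqF.
rewrite cabsM (le_trans (ler_wpM2r (cabs_ge0 _) h2))// mulrAC.
apply: ler_wpM2r; first exact: cabs_ge0.
rewrite mulrAC ler_pdivrMr// ler_wpM2l//; first by rewrite ltW// divr_gt0.
by rewrite lerDl.
Qed.

Lemma hcont_comp (F : C -> C) P t : hcont j P t -> ccont F (P t) ->
  hcont j (fun x => F (P x)) t.
Proof.
move=> cP cF e e0; have [d d0 H] := cF _ e0; have [r r0 Hr] := cP _ d0.
by exists r => // h /Hr /H; rewrite /= [P t + _]addrC subrK.
Qed.

Lemma hcont_cst (c : C) t : hcont j (fun=> c) t.
Proof. exact: hderiv_cont (hderiv_cst _ _). Qed.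

Lemma hcontD P Q t : hcont j P t -> hcont j Q t ->
  hcont j (fun x => P x + Q x) t.
Proof.
move=> dP dQ e e0; have e2 : 0 < e / 2 by rewrite divr_gt0.
have [d1 d10 H1] := dP _ e2; have [d2 d20 H2] := dQ _ e2.
exists (Num.min d1 d2); first by rewrite lt_min d10.
move=> h; rewrite le_min => /andP[/H1 h1 /H2 h2].
have -> : P (t + h) + Q (t + h) - (P t + Q t) =
  (P (t + h) - P t) + (Q (t + h) - Q t) by ring.
by rewrite (le_trans (cabsD _ _))// (le_trans (lerD h1 h2))// -splitr.
Qed.

Lemma hcontM P Q t : hcont j P t -> hcont j Q t ->
  hcont j (fun x => P x * Q x) t.
Proof.
move=> cP cQ e e0.
pose A := cabs (P t) + cabs (Q t) + 1.
have A0 : 0 < A by rewrite /A ltr_wpDl// addr_ge0 ?cabs_ge0.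
have e3 : 0 < Num.min 1 (e / A) by rewrite lt_min ltr01 divr_gt0.
have [d1 d10 H1] := cP _ e3; have [d2 d20 H2] := cQ _ e3.
exists (Num.min d1 d2); first by rewrite lt_min d10.
move=> h; rewrite !le_min => /andP[/H1 + /H2]; rewrite !le_min.
move=> /andP[h1 h1'] /andP[h2 h2'].
have -> : P (t + h) * Q (t + h) - P t * Q t =
  (P (t + h) - P t) * Q t + P t * (Q (t + h) - Q t)
  + (P (t + h) - P t) * (Q (t + h) - Q t) by ring.
apply: (@le_trans _ _ (e / A * cabs (Q t) + cabs (P t) * (e / A) + 1 * (e / A))).
  rewrite (le_trans (cabsD _ _))// lerD//.
    by rewrite (le_trans (cabsD _ _))// !cabsM lerD// ler_pM ?cabs_ge0.
  by rewrite cabsM ler_pM ?cabs_ge0.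
have -> : e / A * cabs (Q t) + cabs (P t) * (e / A) + 1 * (e / A) = e / A * A.
  by move: (e / A) => B; rewrite /A; ring.
by rewrite divfK ?gt_eqF.
Qed.

Lemma hcontB P Q t : hcont j P t -> hcont j Q t ->
  hcont j (fun x => P x - Q x) t.
Proof.
move=> cP cQ; apply: hcontD cP _ => e /cQ[d d0 H]; exists d => // h /H.
by rewrite -opprD cabsN.
Qed.

End Generic.

Lemma cderiv_inv (z : C) : z != 0 -> cderiv (fun x => x^-1) z (- z ^- 2).
Proof.
move=> z0 e e0.
have a0 : 0 < cabs z by rewrite cabs_gt0.
exists (Num.min (cabs z / 2) (e * cabs z ^+ 3 / 2)).
  by rewrite lt_min !divr_gt0// mulr_gt0// exprn_gt0.
move=> h; rewrite le_min => /andP[h1 h2].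
have b0 : cabs z / 2 <= cabs (z + h).
  have := cabsD (z + h) (- h); rewrite addrK cabsN => H.
  by have := splitr (cabs z); lra.
have b1 : 0 < cabs (z + h) by apply: lt_le_trans b0; rewrite divr_gt0.
have zh : z + h != 0 by rewrite -cabs_gt0.
have -> : (z + h)^-1 - z^-1 - h * - z ^- 2 = h * (h / (z ^+ 2 * (z + h))).
  by field; rewrite z0 zh.
rewrite cabsM mulrC ler_wpM2r ?cabs_ge0// cabsM cabsV cabsM cabsX.
rewrite ler_pdivrMr ?mulr_gt0 ?exprn_gt0//; apply: (le_trans h2).
have -> : e * cabs z ^+ 3 / 2 = e * (cabs z ^+ 2 * (cabs z / 2)) by ring.
by rewrite !ler_wpM2l ?exprn_ge0 ?cabs_ge0// ltW.
Qed.

Lemma rderiv_id t : rderiv rc t 1. Proof. exact: hderiv_id. Qed.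

Lemma rderiv_Re P t l : rderiv P t l ->
  is_derive t 1 (fun x => complex.Re (P x)) (complex.Re l).
Proof.
move=> dP.
have C1 : (fun h => h^-1 *: (((fun x => complex.Re (P x)) \o shift t) (h *: 1)
      - complex.Re (P t))) @ 0^' --> complex.Re l.
  apply/cvgrPdist_le => e e0; have [d d0 Hd] := dP _ e0.
  exists d => //= h; rewrite /ball_ /= sub0r normrN => hd h0.
  have := Hd h; rewrite cabs_rc => /(_ (ltW hd)) H.
  have hn0 : 0 < `|h| by rewrite normr_gt0.
  rewrite -(ler_pM2r hn0) -normrM (le_trans _ H)//.
  apply: le_trans (cabs_Re _); rewrite !(ReD, ReN) ReM_rc [h *: 1]mulr1.
  rewrite -normrN [h + t]addrC /GRing.scale/=; rewrite le_eqVlt; apply/orP; left; apply/eqP.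
  congr (`| _ |).
  by rewrite mulrBl mulrAC mulVf// mul1r opprB [h * _]mulrC.
split; first by apply/cvg_ex; exists (complex.Re l).
exact/cvg_lim.
Qed.

End Derivatives.

(** * Integration over one period *)

Section Integral.
Context {R : realType}.
Local Notation C := R[i].
Local Notation rc := (real_complex R).

(** Testing against the direction of the increment reduces this to the mean value
   theorem for one real function. *)
Lemma rderiv_increment_le (P f : R -> C) (a b M : R) : a <= b ->
  (forall t, a <= t <= b -> rderiv P t (f t)) ->
  (forall t, a <= t <= b -> cabs (f t) <= M) ->
  cabs (P b - P a) <= M * (b - a).
Proof.
move=> ab dP fM; set D := P b - P a.
have [D0|D0] := eqVneq D 0.
  rewrite D0 cabs0 mulr_ge0 ?subr_ge0// (le_trans (cabs_ge0 (f a)))// fM//.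
  by rewrite lexx ab.
pose Q t := complex.Re (conjc D * P t).
have dQ (t : R) : t \in `[a, b]%R -> is_derive t 1 Q (complex.Re (conjc D * f t)).
  rewrite in_itv/= => /dP H; apply: rderiv_Re.
  exact: hderivZ.
have dQ' (t : R) : t \in `]a, b[%R -> is_derive t 1 Q (complex.Re (conjc D * f t)).
  by move=> tab; apply: dQ; apply: subset_itv_oo_cc.
have cQ : {within `[a, b], continuous Q}.
  by apply: derivable_within_continuous => x /dQ [].
have [c cab] := MVT_segment ab dQ' cQ.
rewrite /Q -ReN -ReD -mulrN -mulrDr -/D conj_mul/= => E.
have D1 : 0 < cabs D by rewrite cabs_gt0.
rewrite -(ler_pM2l D1) -expr2 E mulrA ler_wpM2r ?subr_ge0//.
rewrite (le_trans (ler_norm _))// (le_trans (cabs_Re _))// cabsM cabs_conj.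
by rewrite ler_wpM2l ?cabs_ge0// fM.
Qed.

Lemma rcont_continuous (g : R -> R) t :
  rcont (fun x => rc (g x)) t -> {for t, continuous g}.
Proof.
move=> cg; apply/cvgrPdist_le => e /cg[d d0 H].
exists d => //= s; rewrite /ball_/= => sd.
have := H (s - t); rewrite cabs_rc distrC => /(_ (ltW sd)).
by rewrite [t + _]addrC subrK -rmorphB cabs_rc distrC.
Qed.

Lemma rcont_Re (f : R -> C) t : rcont f t ->
  rcont (fun x => rc (complex.Re (f x))) t.
Proof.
move=> cf e /cf[d d0 H]; exists d => // h /H; apply: le_trans.
by rewrite -rmorphB cabs_rc -ReN -ReD cabs_Re.
Qed.

Lemma rcont_Im (f : R -> C) t : rcont f t ->
  rcont (fun x => rc (complex.Im (f x))) t.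
Proof.
move=> cf e /cf[d d0 H]; exists d => // h /H; apply: le_trans.
by rewrite -rmorphB cabs_rc -ImN -ImD cabs_Im.
Qed.

Lemma rderiv_rc (g : R -> R) (t l : R) : is_derive t 1 g l ->
  rderiv (fun x => rc (g x)) t (rc l).
Proof.
move=> [dg gl] e e0.
have /cvgrPdist_le/(_ _ e0)[d /= d0 H] : (fun h => h^-1 *: ((g \o shift t) (h *: 1) - g t)) @ 0^' --> l.
  by rewrite -gl.
exists (d / 2); first by rewrite divr_gt0.
move=> h; rewrite cabs_rc => hd.
have [->|h0] := eqVneq h 0.
  by rewrite addr0 subrr rmorph0 mul0r subr0 cabs0 normr0 mulr0.
have hn0 : 0 < `|h| by rewrite normr_gt0.
have hd' : `|h| < d.
  by rewrite (le_lt_trans hd)// ltr_pdivrMr// mulr2n mulrDr mulr1 ltrDl.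
have := H h; rewrite /ball_ /= sub0r normrN => /(_ hd' h0).
rewrite [h *: 1]mulr1 -(ler_pM2r hn0) -normrM => H'; rewrite (le_trans _ H')//.
rewrite -!rmorphB -rmorphM -rmorphB cabs_rc -normrN [h + t]addrC /GRing.scale/=.
rewrite le_eqVlt; apply/orP; left; apply/eqP; congr (`| _ |).
by rewrite mulrBl mulrAC mulVf// mul1r opprB [h * _]mulrC.
Qed.

Lemma real_primitive (g : R -> R) : continuous g ->
  exists G : R -> R, forall t : R, 0 <= t -> is_derive t 1 G (g t).
Proof.
move=> cg; exists (fun x => \int[lebesgue_measure]_(s in `[(-1), x]) g s)%R.
move=> t t0.
have [] := @continuous_FTC1_closed R g (-1) t (t + 1) _ _ _ (cg t).
- by rewrite ltrDl.
- apply: continuous_compact_integrable; first exact: segment_compact.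
  by apply: continuous_subspaceT.
- by apply: lt_le_trans t0; rewrite oppr_lt0.
by move=> dG; rewrite derive1E => E; split.
Qed.

Definition primitive (f P : R -> C) :=
  forall t, 0 <= t <= 2 * pi -> rderiv P t (f t).

Lemma primitive_exists (f : R -> C) : (forall t, rcont f t) ->
  exists P, primitive f P.
Proof.
move=> cf.
have [A HA] := real_primitive (fun t => rcont_continuous (rcont_Re (cf t))).
have [B HB] := real_primitive (fun t => rcont_continuous (rcont_Im (cf t))).
exists (fun t => rc (A t) + 'i%C * rc (B t)) => t /andP[t0 _].
have -> : f t = rc (complex.Re (f t)) + 'i%C * rc (complex.Im (f t)).
  exact: complexE.
apply: hderivD; first exact/rderiv_rc/HA.
exact/hderivZ/rderiv_rc/HB.
Qed.

(** The increment of any primitive: linearity and the fundamental theorem then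
   come for free, without measurability side conditions. *)
Definition cint (f : R -> C) : C :=
  let P := xget (fun=> 0) [set P | primitive f P] in P (2 * pi) - P 0.

Lemma pi2_ge0 : 0 <= 2 * pi :> R. Proof. by rewrite mulr_ge0// pi_ge0. Qed.

Lemma cintE (f P : R -> C) : primitive f P -> cint f = P (2 * pi) - P 0.
Proof.
move=> dP; rewrite /cint; set Q := xget _ _.
have dQ : primitive f Q.
  by rewrite /Q; apply: (@xgetPex _ (fun=> 0) [set P | primitive f P]); exists P.
apply/eqP; rewrite -subr_eq0 -cabs_eq0 eq_le cabs_ge0 andbT.
rewrite (_ : _ - _ = (Q (2 * pi) - P (2 * pi)) - (Q 0 - P 0)); last by ring.
rewrite -[leRHS](mul0r (2 * pi - 0)).
apply: (@rderiv_increment_le (fun t => Q t - P t) (fun=> 0)) => //.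
- exact: pi2_ge0.
- by move=> t t0; rewrite -(subrr (f t)); apply: hderivB; [exact: dQ|exact: dP].
- by move=> t _; rewrite cabs0.
Qed.

Lemma cint_le (f : R -> C) M : (forall t, rcont f t) ->
  (forall t, 0 <= t <= 2 * pi -> cabs (f t) <= M) ->
  cabs (cint f) <= M * (2 * pi).
Proof.
move=> /primitive_exists[P dP] fM; rewrite (cintE dP) -{2}[2 * pi]subr0.
by apply: rderiv_increment_le dP _ => //; exact: pi2_ge0.
Qed.

Lemma cintZ (c : C) (f : R -> C) : (forall t, rcont f t) ->
  cint (fun t => c * f t) = c * cint f.
Proof.
move=> /primitive_exists[P dP].
rewrite (cintE dP) (@cintE _ (fun t => c * P t)); first by rewrite mulrBr.
by move=> t t0; apply: hderivZ; exact: dP.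
Qed.

Lemma cintB (f g : R -> C) : (forall t, rcont f t) -> (forall t, rcont g t) ->
  cint (fun t => f t - g t) = cint f - cint g.
Proof.
move=> /primitive_exists[P dP] /primitive_exists[Q dQ].
rewrite (cintE dP) (cintE dQ) (@cintE _ (fun t => P t - Q t)); first by ring.
by move=> t t0; apply: hderivB; [exact: dP|exact: dQ].
Qed.

Lemma cint_cst (c : C) : cint (fun=> c) = rc (2 * pi) * c.
Proof.
rewrite (@cintE _ (fun t => c * rc t)).
  by rewrite rmorph0 mulr0 subr0 mulrC.
by move=> t t0; rewrite -{2}[c]mulr1; apply: hderivZ; exact: hderiv_id.
Qed.

Lemma cint_ext (f g : R -> C) : f =1 g -> cint f = cint g.
Proof. by move=> /funext ->. Qed.

Definition expi (t : R) : C := (cos t +i* sin t)%C.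

Lemma cabs_expi t : cabs (expi t) = 1.
Proof. by rewrite cabs_sqrt/= cos2Dsin2 sqrtr1. Qed.

Lemma expi_neq0 t : expi t != 0.
Proof. by rewrite -cabs_eq0 cabs_expi oner_eq0. Qed.

Lemma expi0 : expi 0 = 1. Proof. by rewrite /expi cos0 sin0. Qed.

Lemma expi_2pi : expi (2 * pi) = 1.
Proof. by rewrite /expi mulr_natl cos2pi sin2pi. Qed.

Lemma rderiv_expi t : rderiv expi t ('i%C * expi t).
Proof.
have E x : expi x = rc (cos x) + 'i%C * rc (sin x).
  by rewrite (complexE (expi x)).
have -> : 'i%C * expi t = rc (- sin t) + 'i%C * rc (cos t).
  by apply/eqP; rewrite eq_complex /=; apply/andP; split; apply/eqP; ring.
apply: (@hderiv_near _ _ rc (fun x => rc (cos x) + 'i%C * rc (sin x)) _ _ _ 1) => //.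
by apply: hderivD; [|apply: hderivZ]; exact: rderiv_rc.
Qed.

Lemma rcont_expi t : rcont expi t.
Proof. exact: hderiv_cont (rderiv_expi t). Qed.

End Integral.

(** * Cauchy theory on discs *)

Section Holomorphic.
Context {R : realType}.
Local Notation C := R[i].
Local Notation rc := (real_complex R).
Implicit Types (U : set C) (F : C -> C) (z w : C).

Definition holo U F F' := (forall z, U z -> cderiv F z (F' z)) /\
  (forall z, U z -> ccont F' z).

Definition cball z (r : R) : set C := [set w | cabs (w - z) <= r].

Lemma cball_add z r h : cball z r (z + h) = (cabs h <= r) :> Prop.
Proof. by rewrite /cball/= addrAC subrr add0r. Qed.

Lemma cballP z r U : cball z r `<=` U <-> forall h, cabs h <= r -> U (z + h).
Proof.
split=> [H h hr|H w wr]; first by apply: H; rewrite cball_add.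
by have := H _ wr; rewrite addrC subrK.
Qed.

Lemma cball_sub z w r s : cabs (w - z) + s <= r -> cball w s `<=` cball z r.
Proof.
move=> H x; rewrite /cball/= => xs; rewrite (le_trans _ H)//.
rewrite [_ + s]addrC (_ : x - z = (x - w) + (w - z)); last by ring.
by rewrite (le_trans (cabsD _ _))// lerD2r.
Qed.

Definition copen U := forall z, U z -> exists2 r, 0 < r & cball z r `<=` U.

Lemma cderiv_shift F z w l : cderiv (fun x => F (z + x)) w l <-> cderiv F (z + w) l.
Proof. by split=> H e /H[d d0 Hd]; exists d => // h /Hd; rewrite addrA. Qed.

Lemma cderiv_unique F z l m : cderiv F z l -> cderiv F z m -> l = m.
Proof.
move=> dl dm; apply/eqP; rewrite -subr_eq0 -cabs_eq0 eq_le cabs_ge0 andbT.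
apply/ler_addgt0Pr => e e0; rewrite add0r.
have e2 : 0 < e / 2 by rewrite divr_gt0.
have [d1 d10 H1] := dl _ e2; have [d2 d20 H2] := dm _ e2.
pose d := Num.min d1 d2; have d0 : 0 < d by rewrite lt_min d10.
have hd : cabs (rc d) = d by rewrite cabs_rc gtr0_norm.
have := H1 (rc d); have := H2 (rc d); rewrite hd => h2 h1.
have {}h1 : cabs (F (z + rc d) - F z - rc d * l) <= e / 2 * d.
  by apply: h1; rewrite ge_min lexx.
have {}h2 : cabs (F (z + rc d) - F z - rc d * m) <= e / 2 * d.
  by apply: h2; rewrite ge_min lexx orbT.
rewrite -(ler_pM2l d0) -{1}hd -cabsM mulrC.
rewrite (_ : (l - m) * rc d = (F (z + rc d) - F z - rc d * m)
  - (F (z + rc d) - F z - rc d * l)); last by ring.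
rewrite (le_trans (cabsD _ _))// cabsN (le_trans (lerD h2 h1))// -mulrDl.
by rewrite -splitr mulrC.
Qed.

Lemma cderiv_rderiv F z w l (s : R) : cderiv F (z + rc s * w) l ->
  rderiv (fun x => F (z + rc x * w)) s (w * l).
Proof.
move=> dF; apply: (@hderiv_comp _ _ rc F (fun x => z + rc x * w)) dF.
rewrite -[X in hderiv _ _ _ X]add0r; apply: hderivD; first exact: hderiv_cst.
rewrite -[X in hderiv _ _ _ X]addr0 -[X in X + _]mul1r -[X in _ + X](mulr0 (rc s)).
by apply: (hderivM (rderiv_id _)); exact: hderiv_cst.
Qed.

Lemma increment_le F F' z h M :
  (forall s : R, 0 <= s <= 1 -> cderiv F (z + rc s * h) (F' (z + rc s * h))) ->
  (forall s : R, 0 <= s <= 1 -> cabs (F' (z + rc s * h)) <= M) ->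
  cabs (F (z + h) - F z) <= M * cabs h.
Proof.
move=> dF bF.
have := @rderiv_increment_le _ (fun s => F (z + rc s * h))
  (fun s => h * F' (z + rc s * h)) 0 1 (cabs h * M) ler01.
rewrite rmorph0 rmorph1 mul0r mul1r addr0 subr0 mulr1 [cabs h * M]mulrC; apply.
  by move=> s s01; apply: cderiv_rderiv; exact: dF.
by move=> s s01; rewrite cabsM [leLHS]mulrC ler_wpM2r ?cabs_ge0// bF.
Qed.

Lemma taylor1_le F F' z h e :
  (forall s : R, 0 <= s <= 1 -> cderiv F (z + rc s * h) (F' (z + rc s * h))) ->
  (forall s : R, 0 <= s <= 1 -> cabs (F' (z + rc s * h) - F' z) <= e) ->
  cabs (F (z + h) - F z - h * F' z) <= e * cabs h.
Proof.
move=> dF bF.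
have := @increment_le (fun x => F x - F' z * x) (fun x => F' x - F' z) z h e.
rewrite (_ : _ - (F z - _) = F (z + h) - F z - h * F' z); last by ring.
apply=> // s s01; apply: hderivB; first exact: dF.
rewrite -[X in hderiv _ _ _ X]mulr1; apply: hderivZ; exact: (hderiv_id idfun).
Qed.

(** Compactness of the parameter interval makes continuity at the points of the
   curve uniform, also towards points off the curve. *)
Lemma uniform_cont_curve F (g : R -> C) : (forall t, rcont g t) ->
  (forall t, 0 <= t <= 2 * pi -> ccont F (g t)) -> forall e, 0 < e ->
  exists2 d, 0 < d & forall t h, 0 <= t <= 2 * pi -> cabs h <= d ->
    cabs (F (g t + h) - F (g t)) <= e.
Proof.
move=> cg cF e e0.
have /compact_near_coveringP/near_covering_withinP := @segment_compact R 0 (2 * pi).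
move=> /(_ R (0^'+) (fun d t => forall h, cabs h <= d ->
  cabs (F (g t + h) - F (g t)) <= e)).
case.
  move=> x; rewrite /= in_itv/= => xI.
  have e2 : 0 < e / 2 by rewrite divr_gt0.
  have [d d0 Hd] := cF x xI _ e2; have d2 : 0 < d / 2 by rewrite divr_gt0.
  have [r r0 Hr] := cg x _ d2.
  exists ([set t | `|x - t| < r], [set s | s <= d / 2]) => /=.
    split; first by exists r => //= t.
    exists (d / 2) => //= s; rewrite /ball_/= sub0r normrN => + s0.
    by rewrite gtr0_norm// => /ltW.
  move=> [t s]/= [xt sd] _ h hs.
  have gt : cabs (g t - g x) <= d / 2.
    by have := Hr (t - x); rewrite cabs_rc distrC [x + (t - x)]addrC subrK => /(_ (ltW xt)).
  rewrite (_ : _ - _ = (F (g x + (g t - g x + h)) - F (g x))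
     - (F (g x + (g t - g x)) - F (g x))); last first.
    by rewrite addrA [g x + (g t - g x)]addrC subrK; ring.
  rewrite (le_trans (cabsD _ _))// cabsN [e]splitr lerD// Hd//.
    by rewrite (le_trans (cabsD _ _))// [d]splitr lerD// (le_trans hs).
  by rewrite (le_trans gt)// [leRHS]splitr lerDl ltW.
move=> r /= r0 Hr; exists (r / 2); first by rewrite divr_gt0.
move=> t h tI; apply: (Hr (r / 2)); last 2 first.
- by rewrite divr_gt0.
- by rewrite /= in_itv.
rewrite /= sub0r normrN gtr0_norm ?divr_gt0// ltr_pdivrMr//.
by rewrite mulr2n mulrDr mulr1 ltrDl.
Qed.

(** Differentiation under the integral sign; the mean value inequality makes the
   difference quotients converge uniformly along the curve. *)
Lemma cint_cderiv U F F' (g v k : R -> C) rho V K :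
  holo U F F' -> 0 < rho -> (forall t, cball (g t) rho `<=` U) ->
  (forall t, rcont g t) -> (forall t, rcont v t) -> (forall t, rcont k t) ->
  (forall t, cabs (v t) <= V) -> (forall t, cabs (k t) <= K) ->
  cderiv (fun x => cint (fun t => k t * F (g t + x * v t))) 0
    (cint (fun t => k t * (v t * F' (g t)))).
Proof.
move=> [dF cF] rho0 gU cg cv ck vV kK e e0.
have V0 : 0 <= V by rewrite (le_trans _ (vV 0))// cabs_ge0.
have K0 : 0 <= K by rewrite (le_trans _ (kK 0))// cabs_ge0.
have pi0 := @pi_ge0 R.
pose A := K * V * (2 * pi) + 1.
have A0 : 0 < A by rewrite ltr_wpDl// !mulr_ge0.
have gUt t h : cabs h <= rho -> U (g t + h).
  by have /cballP := gU t; apply.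
have gU0 t : U (g t) by rewrite -[g t]addr0; apply: gUt; rewrite cabs0 ltW.
have [d d0 Hd] := uniform_cont_curve cg (fun t _ => cF _ (gU0 t)) (divr_gt0 e0 A0).
have V1 : 0 < V + 1 by rewrite ltr_wpDl.
exists (Num.min d rho / (V + 1)); first by rewrite divr_gt0// lt_min d0.
move=> h /=; rewrite ler_pdivlMr// => hd.
have hv t : cabs (h * v t) <= Num.min d rho.
  by rewrite (le_trans _ hd)// cabsM ler_wpM2l ?cabs_ge0// (le_trans (vV t))// lerDl.
have hvd t : cabs (h * v t) <= d by have := hv t; rewrite le_min => /andP[].
have hvr t : cabs (h * v t) <= rho by have := hv t; rewrite le_min => /andP[].
have cFg (f : R -> C) : (forall t, rcont f t) -> (forall t, U (f t)) ->
    forall t, rcont (fun x => F (f x)) t.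
  by move=> cf Uf t; apply: (hcont_comp (cf t)); exact/hderiv_cont/dF/Uf.
have cFg' t : rcont (fun x => F' (g x)) t.
  by apply: (hcont_comp (cg t)); exact/cF.
have cgh t : rcont (fun x => g x + h * v x) t.
  by apply: (hcontD (cg t)); apply: hcontM (cv t); exact: hcont_cst.
have c1 t : rcont (fun t => k t * F (g t + h * v t)) t.
  apply: (hcontM (ck t)); apply: (cFg (fun x => g x + h * v x)) => // s.
  exact/gUt/hvr.
have c2 t : rcont (fun t => k t * F (g t)) t.
  by apply: (hcontM (ck t)); apply: (cFg g).
have c3 t : rcont (fun t => k t * (v t * F' (g t))) t.
  by apply: (hcontM (ck t)); apply: (hcontM (cv t)); exact: cFg'.
rewrite add0r -cintZ// (@cint_ext _ (fun t => k t * F (g t + 0 * v t)) (fun t => k t * F (g t))); last first.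
  by move=> t; rewrite mul0r addr0.
rewrite -cintB//.
have c4 t : rcont (fun t => k t * F (g t + h * v t) - k t * F (g t)) t.
  exact: hcontB (c1 t) (c2 t).
have c5 t : rcont (fun t => h * (k t * (v t * F' (g t)))) t.
  by apply: hcontM (c3 t); exact: hcont_cst.
rewrite -cintB//.
have -> : e * cabs h = e * cabs h / (2 * pi) * (2 * pi).
  by rewrite divfK// gt_eqF// mulr_gt0// pi_gt0.
apply: cint_le => [t|t t0].
  exact: hcontB (c4 t) (c5 t).
rewrite (_ : _ - _ = k t * (F (g t + h * v t) - F (g t) - (h * v t) * F' (g t))); last by ring.
rewrite cabsM.
have T : cabs (F (g t + h * v t) - F (g t) - (h * v t) * F' (g t)) <= e / A * cabs (h * v t).
  have S (s : R) : 0 <= s <= 1 -> cabs (rc s * (h * v t)) <= cabs (h * v t).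
    move=> /andP[s0 s1]; rewrite cabsM cabs_rc ger0_norm//.
    by rewrite ler_piMl ?cabs_ge0.
  apply: taylor1_le => s s01; first by apply: dF; apply: gUt; exact: le_trans (S _ s01) _.
  by apply: Hd => //; exact: le_trans (S _ s01) _.
apply: (le_trans (ler_pM (cabs_ge0 _) (cabs_ge0 _) (kK t) T)).
rewrite ler_pdivlMr ?mulr_gt0 ?pi_gt0// cabsM.
have ea : 0 <= e / A * cabs h by rewrite mulr_ge0 ?cabs_ge0// ltW ?divr_gt0.
apply: (@le_trans _ _ (e / A * cabs h * (K * V * (2 * pi)))).
  rewrite (_ : K * (_ / _ * _) * _ = e / A * cabs h * (K * cabs (v t) * (2 * pi))); last by ring.
  by rewrite ler_wpM2l// ler_wpM2r ?mulr_ge0// ler_wpM2l.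
apply: (@le_trans _ _ (e / A * cabs h * A)); first by rewrite ler_wpM2l// lerDl.
by rewrite mulrAC divfK// gt_eqF.
Qed.

End Holomorphic.

Section Cauchy.
Context {R : realType}.
Local Notation C := R[i].
Local Notation rc := (real_complex R).
Implicit Types (U : set C) (F : C -> C) (z w : C).

Definition circle z (r : R) (t : R) : C := z + rc r * expi t.

Lemma rcont_circle z r t : rcont (circle z r) t.
Proof.
apply: hcontD; first exact: hcont_cst.
by apply: hcontM; [exact: hcont_cst|exact: rcont_expi].
Qed.

Lemma rcont_expiV (t : R) : rcont (fun x => (expi x)^-1 : C) t.
Proof.
apply: (hcont_comp (rcont_expi t)); apply: hderiv_cont.
exact: cderiv_inv (expi_neq0 t).
Qed.

Lemma cabs_expiV (t : R) : cabs ((expi t)^-1 : C) = 1.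
Proof. by rewrite cabsV cabs_expi invr1. Qed.

Lemma rderiv_circle z r t : rderiv (circle z r) t (rc r * ('i%C * expi t)).
Proof.
rewrite /rderiv -[X in hderiv _ _ _ X]add0r; apply: hderivD; first exact: hderiv_cst.
by apply: hderivZ; exact: rderiv_expi.
Qed.

Lemma cabs_circle z r t : 0 <= r -> cabs (circle z r t - z) = r.
Proof.
by move=> r0; rewrite /circle addrAC subrr add0r cabsM cabs_expi mulr1 cabs_rc ger0_norm.
Qed.

Lemma circle_2pi z r : circle z r (2 * pi) = circle z r 0.
Proof. by rewrite /circle expi_2pi expi0. Qed.

Lemma cball_circle z r s t : 0 <= r -> cball (circle z r t) (s - r) `<=` cball z s.
Proof. by move=> r0; apply: cball_sub; rewrite cabs_circle// addrC subrK. Qed.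

Lemma ineq0 : 'i%C != 0 :> C.
Proof. by rewrite eq_complex /= oner_eq0 andbF. Qed.

(** The integrand is the derivative of [F (circle z s t) / i], which is periodic. *)
Lemma cint_rotate_deriv U F F' z s : holo U F F' -> s != 0 ->
  (forall t, U (circle z s t)) ->
  cint (fun t => rc s * expi t * F' (circle z s t)) = 0.
Proof.
move=> [dF _] s0 Us; have i0 := ineq0.
rewrite (@cintE _ _ (fun t => 'i%C^-1 * F (circle z s t))).
  by rewrite circle_2pi subrr.
move=> t _.
rewrite (_ : _ * _ = 'i%C^-1 * (rc s * ('i%C * expi t) * F' (circle z s t))).
  by apply: hderivZ; apply: (hderiv_comp (rderiv_circle z s t)); exact: dF.
by field.
Qed.

(** The mean over the circle of radius [s * r] has zero derivative in [s]: its
   derivative is the integral of an exact form over a closed curve. *)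
Lemma circle_mean U F F' z r r' : holo U F F' -> 0 < r -> r < r' ->
  cball z r' `<=` U ->
  cint (fun t => F (circle z r t)) = rc (2 * pi) * F z.
Proof.
move=> hF r0 rr' zU; have [dF cF] := hF.
pose v t := rc r * expi t : C.
pose L x := cint (fun t => 1 * F (z + x * v t)).
have cv t : rcont v t by apply: hcontM; [exact: hcont_cst|exact: rcont_expi].
have cabs_v t : cabs (v t) = r by rewrite cabsM cabs_expi mulr1 cabs_rc gtr0_norm.
have gE s t : z + rc s * v t = circle z (s * r) t.
  by rewrite /circle /v rmorphM mulrA.
have rho0 : 0 < r' - r by rewrite subr_gt0.
have gU (s : R) t : 0 <= s <= 1 -> cball (circle z (s * r) t) (r' - r) `<=` U.
  move=> /andP[s0 s1]; apply: subset_trans zU; apply: cball_sub.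
  rewrite cabs_circle ?mulr_ge0 ?(ltW r0)// addrA lerBlDr [leRHS]addrC.
  by rewrite lerD2r ger_pMl.
have dL (s : R) : 0 <= s <= 1 -> cderiv L (0 + rc s * 1) 0.
  move=> s01; rewrite add0r mulr1 -[rc s]addr0; apply/cderiv_shift.
  have := @cint_cderiv _ U F F' (circle z (s * r)) v (fun=> 1) (r' - r) r 1
    hF rho0 (fun t => gU s t s01) (rcont_circle z (s * r)) cv (fun t => hcont_cst _ 1 t)
    (fun t => le_of_eq (cabs_v t)) (fun t => le_of_eq (@cabs1 R)).
  have Us t : U (circle z (s * r) t).
    by apply: (gU s t s01); rewrite /cball/= subrr cabs0 ltW.
  have -> : cint (fun t => 1 * (v t * F' (circle z (s * r) t))) = 0.
    have [s0|s0] := eqVneq s 0; last first.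
      have sr0 : s * r != 0 by rewrite mulf_neq0// gt_eqF.
      rewrite -[RHS](mulr0 (rc s)^-1) -(cint_rotate_deriv hF sr0 Us) -cintZ.
        apply: cint_ext => t; rewrite mul1r rmorphM /v !mulrA mulVf ?mul1r//.
        by apply/eqP => -[]; exact/eqP.
      move=> t; apply: hcontM.
        by apply: hcontM; [exact: hcont_cst|exact: rcont_expi].
      by apply: (hcont_comp (rcont_circle _ _ _)); exact: cF.
    rewrite (@cintE _ _ (fun t => F' z / 'i%C * (rc r * expi t))).
      by rewrite expi_2pi expi0 subrr.
    move=> t _; rewrite mul1r s0 mul0r /circle rmorph0 mul0r addr0 /v.
    rewrite (_ : _ * F' z = F' z / 'i%C * (rc r * ('i%C * expi t))).
      by do 2!apply: hderivZ; exact: rderiv_expi.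
    by field; exact: ineq0.
  apply: (@hderiv_near _ _ idfun _ _ _ _ 1) => // h _; apply: cint_ext => t.
  by rewrite add0r mulrDl addrA gE.
have L1 : L 1 = cint (fun t => F (circle z r t)).
  by apply: cint_ext => t; rewrite !mul1r.
have L0 : L 0 = rc (2 * pi) * F z.
  by rewrite -cint_cst; apply: cint_ext => t; rewrite mul0r addr0 mul1r.
rewrite -L1 -L0; apply/eqP; rewrite -subr_eq0 -cabs_eq0 eq_le cabs_ge0 andbT.
have := @increment_le _ L (fun=> 0) 0 1 0 dL; rewrite add0r mul0r; apply.
by move=> s _; rewrite cabs0.
Qed.

End Cauchy.

Section CauchyEstimate.
Context {R : realType}.
Local Notation C := R[i].
Local Notation rc := (real_complex R).
Implicit Types (U : set C) (F : C -> C) (z w : C).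

Lemma circle_addr z w (r t : R) : circle z r t + w = circle (z + w) r t :> C.
Proof. by rewrite /circle addrAC. Qed.

Lemma circle_in U z (r r' t : R) : 0 <= r <= r' -> cball z r' `<=` U ->
  U (circle z r t).
Proof.
by move=> /andP[r0 rr'] zU; apply: zU; rewrite /cball/= cabs_circle.
Qed.

Lemma rcont_on_circle U G z (r r' t : R) : (forall w, U w -> ccont G w) ->
  0 <= r <= r' -> cball z r' `<=` U -> rcont (fun t => G (circle z r t)) t.
Proof.
move=> cG rr' zU; apply: (hcont_comp (rcont_circle z r t)).
apply: cG; exact: circle_in rr' zU.
Qed.

Lemma holo_cont U F F' z : holo U F F' -> U z -> ccont F z.
Proof. by move=> [dF _] /dF; exact: hderiv_cont. Qed.

(** Translating the circle differentiates the mean value property before a second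
   derivative of [F] is known to exist. *)
Lemma circle_mean_deriv U F F' z (r r' : R) : holo U F F' -> 0 < r -> r < r' ->
  cball z r' `<=` U ->
  cint (fun t => F' (circle z r t)) = rc (2 * pi) * F' z.
Proof.
move=> hF r0 rr' zU; have [dF cF] := hF.
pose rho := (r' - r) / 2.
have rho0 : 0 < rho by rewrite divr_gt0// subr_gt0.
have rhoE : r' = r + rho + rho by rewrite -addrA /rho -splitr addrC subrK.
have gU t : cball (circle z r t) rho `<=` U.
  apply: subset_trans zU; apply: cball_sub; rewrite cabs_circle ?(ltW r0)// rhoE.
  by rewrite lerDl ltW.
have := @cint_cderiv _ U F F' (circle z r) (fun=> 1) (fun=> 1) rho 1 1 hF rho0
  gU (rcont_circle z r) (fun t => hcont_cst _ 1 t) (fun t => hcont_cst _ 1 t)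
  (fun t => le_of_eq (@cabs1 R)) (fun t => le_of_eq (@cabs1 R)).
move=> dG.
have {}dG : cderiv (fun x => rc (2 * pi) * F (z + x)) 0
    (cint (fun t => 1 * (1 * F' (circle z r t)))).
  apply: (hderiv_near rho0 _ dG) => h hr; rewrite add0r.
  rewrite -(@circle_mean _ U F F' _ r (r + rho))//.
  - by apply: cint_ext => t; rewrite mul1r mulr1 circle_addr.
  - by rewrite ltrDl.
  - apply: subset_trans zU; apply: cball_sub.
    by rewrite addrAC subrr add0r rhoE addrC lerD2l.
have dG' : cderiv (fun x => rc (2 * pi) * F (z + x)) 0 (rc (2 * pi) * F' z).
  apply: hderivZ; apply/cderiv_shift; rewrite addr0; apply: dF; apply: zU.
  by rewrite /cball/= subrr cabs0 ltW// (lt_trans r0).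
rewrite -(cderiv_unique dG dG'); apply: cint_ext => t; by rewrite !mul1r.
Qed.

(** Integration by parts turns the mean of [F'] into a Fourier coefficient of [F]
   itself: this is what bounds [F'] by [F] and lets it be differentiated again. *)
Lemma circle_moment U F F' z (r r' : R) : holo U F F' -> 0 < r -> r < r' ->
  cball z r' `<=` U ->
  cint (fun t => (expi t)^-1 * F (circle z r t)) = rc r * (rc (2 * pi) * F' z).
Proof.
move=> hF r0 rr' zU; have [dF cF] := hF.
have rr : 0 <= r <= r' by rewrite !ltW.
rewrite -(circle_mean_deriv hF r0 rr' zU).
have c1 t : rcont (fun t => F' (circle z r t)) t.
  exact: rcont_on_circle cF rr zU.
have c2 t : rcont (fun t => (expi t)^-1 * F (circle z r t)) t.
  apply: hcontM; first exact: rcont_expiV.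
  by apply: rcont_on_circle rr zU => w Uw; exact: holo_cont hF Uw.
rewrite -cintZ//; apply/eqP; rewrite -subr_eq0 -cintB//; last first.
  by move=> t; apply: hcontM (c1 t); exact: hcont_cst.
rewrite (@cintE _ _ (fun t => 'i%C * ((expi t)^-1 * F (circle z r t)))).
  by rewrite circle_2pi expi_2pi expi0 subrr.
move=> t _.
have := hderivM (hderiv_comp (rderiv_expi t) (cderiv_inv (expi_neq0 t)))
  (hderiv_comp (rderiv_circle z r t) (dF _ (circle_in t rr zU))).
move=> /(hderivZ 'i%C).
have -> // : forall a b : C, 'i%C * ('i%C * expi t * - expi t ^- 2 * a +
  (expi t)^-1 * (rc r * ('i%C * expi t) * b)) = (expi t)^-1 * a - rc r * b.
move=> a b; have e0 := expi_neq0 t.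
transitivity (('i%C : C) ^+ 2 * (rc r * b - (expi t)^-1 * a)); first by field.
by rewrite sqr_i mulN1r opprB.
Qed.

Lemma pi2_neq0 : rc (2 * pi) != 0.
Proof. by apply/eqP => -[] /eqP; rewrite mulf_eq0 pnatr_eq0/= gt_eqF// pi_gt0. Qed.

Lemma rc_neq0 (r : R) : r != 0 -> rc r != 0.
Proof. by move=> r0; apply/eqP => -[] /eqP; rewrite (negbTE r0). Qed.

Lemma cauchy_estimate U F F' z (r r' M : R) : holo U F F' -> 0 < r -> r < r' ->
  cball z r' `<=` U -> (forall w, cball z r w -> cabs (F w) <= M) ->
  cabs (F' z) <= M / r.
Proof.
move=> hF r0 rr' zU FM; rewrite ler_pdivlMr// mulrC.
have p0 : 0 < 2 * pi :> R by rewrite mulr_gt0// pi_gt0.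
have rr : 0 <= r <= r' by rewrite !ltW.
have := congr1 (@cabs R) (circle_moment hF r0 rr' zU).
rewrite !cabsM !cabs_rc !gtr0_norm// [2 * pi * _]mulrC mulrA => E.
rewrite -(ler_pM2r p0) -E; apply: cint_le => [t|t _].
  apply: hcontM; first exact: rcont_expiV.
  by apply: rcont_on_circle rr zU => w Uw; exact: holo_cont hF Uw.
by rewrite cabsM cabs_expiV mul1r FM// /cball/= cabs_circle ?(ltW r0).
Qed.

(** The centre only enters the first moment through a translation of [F], so the
   moment can be differentiated under the integral once more. *)
Lemma cderiv_deriv U F F' z (r r' : R) : holo U F F' -> 0 < r -> r < r' ->
  cball z r' `<=` U ->
  cderiv F' z ((rc r * rc (2 * pi))^-1 *
     cint (fun t => (expi t)^-1 * F' (circle z r t))).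
Proof.
move=> hF r0 rr' zU; have [dF cF] := hF.
pose rho := (r' - r) / 2.
have rho0 : 0 < rho by rewrite divr_gt0// subr_gt0.
have rhoE : r' = r + rho + rho by rewrite -addrA /rho -splitr addrC subrK.
have gU t : cball (circle z r t) rho `<=` U.
  apply: subset_trans zU; apply: cball_sub; rewrite cabs_circle ?(ltW r0)// rhoE.
  by rewrite lerDl ltW.
have dG := @cint_cderiv _ U F F' (circle z r) (fun=> 1) (fun t => (expi t)^-1) rho 1 1 hF rho0
  gU (rcont_circle z r) (fun t => hcont_cst _ 1 t) rcont_expiV
  (fun t => le_of_eq (@cabs1 R)) (fun t => le_of_eq (cabs_expiV t)).
rewrite -[z in cderiv _ z _]addr0; apply/cderiv_shift.
have {}dG := hderivZ (rc r * rc (2 * pi))^-1 dG.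
rewrite (@cint_ext _ (fun t => (expi t)^-1 * F' (circle z r t))
  (fun t => (expi t)^-1 * (1 * F' (circle z r t)))); last by move=> t; rewrite mul1r.
apply: (hderiv_near rho0 _ dG) => h hr; rewrite add0r.
rewrite (@cint_ext _ _ (fun t => (expi t)^-1 * F (circle (z + h) r t))); last first.
  by move=> t; rewrite mulr1 circle_addr.
rewrite (@circle_moment U F F' _ r (r + rho))//.
- by rewrite [rc r * (_ * _)]mulrA mulKf// mulf_neq0 ?pi2_neq0 ?rc_neq0 ?gt_eqF.
- by rewrite ltrDl.
- apply: subset_trans zU; apply: cball_sub.
  by rewrite addrAC subrr add0r rhoE addrC lerD2l.
Qed.

Lemma holo_deriv U F F' : copen U -> holo U F F' -> exists F'', holo U F' F''.
Proof.
move=> oU hF; have [dF cF] := hF.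
exists (fun z => xget 0 [set l | cderiv F' z l]); split=> z Uz.
  have [r r0 zU] := oU z Uz.
  have r2 : r / 2 < r by rewrite ltr_pdivrMr// mulr2n mulrDr mulr1 ltrDl.
  have r20 : 0 < r / 2 by rewrite divr_gt0.
  apply: (@xgetPex _ 0 [set l | cderiv F' z l]); eexists.
  exact: cderiv_deriv hF r20 r2 zU.
have [r r0 zU] := oU z Uz.
pose s := r / 3.
have s0 : 0 < s by rewrite divr_gt0.
have sr : s < r by rewrite ltr_pdivrMr// ltr_pMr// ltr1n.
have srr : s + s < r by rewrite /s; lra.
pose c := (rc s * rc (2 * pi))^-1.
have E h : cabs h <= s -> xget 0 [set l | cderiv F' (z + h) l] =
    c * cint (fun t => (expi t)^-1 * F' (circle z s t + h)).
  move=> hs; have zhU : cball (z + h) (r - s) `<=` U.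
    apply: subset_trans zU; apply: cball_sub.
    by rewrite addrAC subrr add0r addrCA gerDl subr_le0.
  have s1 : s < r - s by rewrite ltrBrDr.
  have D := cderiv_deriv hF s0 s1 zhU.
  have X : cderiv F' (z + h) (xget 0 [set l | cderiv F' (z + h) l]).
    by apply: (@xgetPex _ 0 [set l | cderiv F' (z + h) l]); eexists; exact: D.
  rewrite (cderiv_unique X D); congr (_ * _); apply: cint_ext => t.
  by rewrite circle_addr.
move=> e e0; have p0 : 0 < 2 * pi :> R by rewrite mulr_gt0// pi_gt0.
have c0 : 0 < cabs c.
  by rewrite cabs_gt0 invr_eq0 mulf_neq0 ?pi2_neq0 ?rc_neq0 ?gt_eqF.
have e1 : 0 < e / cabs c / (2 * pi) by rewrite !divr_gt0.
have ss : 0 <= s <= r by rewrite !ltW.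
have [d d0 Hd] := uniform_cont_curve (rcont_circle z s)
   (fun t _ => cF _ (circle_in t ss zU)) e1.
exists (Num.min d s); first by rewrite lt_min d0.
move=> h /=; rewrite le_min => /andP[hd hs].
rewrite E// -[z in X in _ - X]addr0 E ?cabs0 ?(ltW s0)// -mulrBr cabsM [leLHS]mulrC -ler_pdivlMr//.
have cc k : cabs k <= s -> forall t, rcont (fun t => (expi t)^-1 * F' (circle z s t + k)) t.
  move=> ks t; apply: hcontM; first exact: rcont_expiV.
  have Uk : U (circle z s t + k).
    apply: zU; apply: (@cball_circle _ z s r t (ltW s0)).
    rewrite /cball/= [_ + k]addrC addrK (le_trans ks)// lerBrDr.
    exact: ltW.
  apply: (hcont_comp (hcontD (rcont_circle z s t) (hcont_cst _ k t))).
  exact: cF Uk.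
have cc0 : forall t, rcont (fun t => (expi t)^-1 * F' (circle z s t + 0)) t.
  by apply: cc; rewrite cabs0 ltW.
rewrite -cintB//; last exact: cc.
rewrite -[leRHS](divfK (lt0r_neq0 p0)); apply: cint_le => [t|t tI].
  exact: hcontB (cc _ hs t) (cc0 t).
rewrite addr0 -mulrBr cabsM cabs_expiV mul1r.
exact: Hd.
Qed.

End CauchyEstimate.

(** * Iterated derivatives of holomorphic functions *)

Section IteratedDerivatives.
Context {R : realType}.
Local Notation C := R[i].
Local Notation rc := (real_complex R).
Implicit Types (U : set C) (f g : C -> C^o) (z w : C).

Lemma gt0_rc (e : C) : 0 < e -> e = rc (complex.Re e) /\ 0 < complex.Re e.
Proof.
by case: e => a b; rewrite ltcE/= => /andP[/eqP -> a0]; split.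
Qed.

Lemma cderiv_cvg f z l : cderiv f z l <->
  (fun h => h^-1 *: (f (h + z) - f z) : C^o) @ (0 : C^o)^' --> (l : C^o).
Proof.
have E (h : C) : h != 0 -> h^-1 *: (f (h + z) - f z) - l =
    (f (z + h) - f z - h * l) / h.
  move=> h0; rewrite /GRing.scale/= [z + h]addrC; field.
  exact: h0.
split=> [df|/cvgrPdist_le cf].
  apply/cvgrPdist_le => e /gt0_rc[-> e0]; have [d d0 Hd] := df _ e0.
  exists (rc d); first by rewrite /= ltcR.
  move=> h; rewrite /ball_/= sub0r normrN normC_cabs ltcR => /ltW hd h0.
  rewrite distrC E// normC_cabs lecR cabsM cabsV ler_pdivrMr ?cabs_gt0//.
  exact: Hd.
move=> e e0; have [|d /gt0_rc[dE d0] Hd] := cf (rc e); first by rewrite ltcR.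
exists (complex.Re d / 2); first by rewrite divr_gt0.
move=> h /= hd; have [->|h0] := eqVneq h 0.
  by rewrite addr0 subrr mul0r subr0 cabs0 mulr0.
have := Hd h; rewrite /ball_/= sub0r normrN normC_cabs dE ltcR.
rewrite distrC E// normC_cabs lecR cabsM cabsV ler_pdivrMr ?cabs_gt0//.
apply=> //; apply: (le_lt_trans hd).
by rewrite ltr_pdivrMr// ltr_pMr// ltr1n.
Qed.

Lemma cderiv_derive1 f z l : cderiv f z l -> f^`() z = l.
Proof. by move=> /cderiv_cvg H; exact: cvg_lim H. Qed.

Lemma derivable_cderiv f z : derivable (f : C^o -> C^o) z 1 ->
  cderiv f z (f^`() z).
Proof.
move=> /cvg_ex[l H]; have /cderiv_cvg df : (fun h => h^-1 *: (f (h + z) - f z) : C^o) @ (0 : C^o)^' --> (l : C^o).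
  apply: cvg_trans H; apply: near_eq_cvg; near=> h => /=.
  by rewrite [h *: 1]mulr1.
by rewrite (cderiv_derive1 df).
Unshelve. all: by end_near. Qed.

Lemma cderiv_derivable f z l : cderiv f z l -> derivable (f : C^o -> C^o) z 1.
Proof.
move=> /cderiv_cvg H; apply/cvg_ex; exists l.
apply: cvg_trans H; apply: near_eq_cvg; near=> h => /=.
by rewrite [h *: 1]mulr1.
Unshelve. all: by end_near. Qed.

Definition hol U f := holo U f f^`().

Lemma hol_cderiv U f z : hol U f -> U z -> cderiv f z (f^`() z).
Proof. by move=> [df _] /df. Qed.

Lemma holo_eq U f F F' g : copen U -> holo U F F' -> (forall z, U z -> f z = F z) ->
  (forall z, U z -> g z = F' z) -> holo U f g.
Proof.
move=> oU [dF cF] fF gF; split=> z Uz; have [r r0 /cballP zU] := oU z Uz.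
  rewrite gF//; apply: (hderiv_near r0 _ (dF z Uz)) => h hr.
  by rewrite fF//; exact: zU.
apply: (hcont_near r0 _ (cF z Uz)) => h hr.
by rewrite gF//; exact: zU.
Qed.

Lemma holo_hol U f F' : copen U -> holo U f F' ->
  hol U f /\ forall z, U z -> f^`() z = F' z.
Proof.
move=> oU hf; have E z : U z -> f^`() z = F' z.
  by move=> Uz; apply: cderiv_derive1; exact: hf.1.
by split=> //; apply: holo_eq oU hf _ _.
Qed.

Lemma hol_eq U f g : copen U -> hol U g -> (forall z, U z -> f z = g z) ->
  hol U f /\ forall z, U z -> f^`() z = g^`() z.
Proof. by move=> oU hg fg; apply: holo_hol => //; exact: holo_eq oU hg fg _. Qed.

Lemma hol_derive U f : copen U -> hol U f -> hol U f^`().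
Proof. by move=> oU /(holo_deriv oU)[g /(holo_hol oU)[]]. Qed.

Lemma hol_derivn U f n : copen U -> hol U f -> hol U f^`(n).
Proof. move=> oU hf; elim: n => [|n IH]; first exact: hf.
by rewrite derive1nS; exact: hol_derive. Qed.

Lemma derivn_eq U f g n : copen U -> hol U g -> (forall z, U z -> f z = g z) ->
  forall z, U z -> f^`(n) z = g^`(n) z.
Proof.
move=> oU hg fg; elim: n => [|n IH]; first exact: fg.
by have [] := hol_eq oU (hol_derivn n oU hg) IH.
Qed.

Lemma holo_cst U (c : C) : holo U (fun=> c) (fun=> 0).
Proof. by split=> z _; [exact: hderiv_cst|exact: hcont_cst]. Qed.

Lemma holo_id U : holo U id (fun=> 1).
Proof. by split=> z _; [exact: (hderiv_id idfun)|exact: hcont_cst]. Qed.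

Lemma holoD U f f' g g' : holo U f f' -> holo U g g' ->
  holo U (fun z => f z + g z) (fun z => f' z + g' z).
Proof.
move=> [df cf] [dg cg]; split=> z Uz.
  by apply: hderivD; [exact: df|exact: dg].
by apply: hcontD; [exact: cf|exact: cg].
Qed.

Lemma holoM U f f' g g' : holo U f f' -> holo U g g' ->
  holo U (fun z => f z * g z) (fun z => f' z * g z + f z * g' z).
Proof.
move=> hf hg; have [df cf] := hf; have [dg cg] := hg; split=> z Uz.
  by apply: hderivM; [exact: df|exact: dg].
apply: hcontD; apply: hcontM.
- exact: cf.
- exact: holo_cont hg Uz.
- exact: holo_cont hf Uz.
- exact: cg.
Qed.

Lemma holoZ U (c : C) f f' : holo U f f' ->
  holo U (fun z => c * f z) (fun z => c * f' z).
Proof.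
move=> [df cf]; split=> z Uz; first by apply: hderivZ; exact: df.
by apply: hcontM; [exact: hcont_cst|exact: cf].
Qed.

Lemma holo_comp U V f f' g g' : holo U f f' -> holo V g g' ->
  (forall z, U z -> V (f z)) ->
  holo U (fun z => g (f z)) (fun z => f' z * g' (f z)).
Proof.
move=> hf [dg cg] UV; have [df cf] := hf; split=> z Uz.
  by apply: (hderiv_comp (df z Uz)); exact/dg/UV.
apply: hcontM; first exact: cf.
by apply: (hcont_comp (holo_cont hf Uz)); exact/cg/UV.
Qed.

Lemma holo_inv U f f' : holo U f f' -> (forall z, U z -> f z != 0) ->
  holo U (fun z => (f z)^-1) (fun z => f' z * - (f z) ^- 2).
Proof.
move=> hf f0.
apply: (@holo_comp _ [set z | z != 0] f f' (fun z => z^-1) (fun z => - z ^- 2)) => //.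
split=> z /= z0; first exact: cderiv_inv.
have V := hderiv_cont (cderiv_inv z0).
have := hcontM (hcont_cst idfun (-1) z) (hcontM V V).
by apply: (@hcont_near _ _ idfun _ _ _ 1) => // h _; rewrite mulN1r -expr2 exprVn.
Qed.

Lemma derivnZ U f (c : C) n : copen U -> hol U f -> forall z, U z ->
  (fun x => c * f x : C^o)^`(n) z = c * derive1n n f z.
Proof.
move=> oU hf; elim: n => [|n IH] z Uz; first by [].
have hn := hol_derivn n oU hf.
have hZ := holoZ c hn.
have [_ E] := holo_hol oU (holo_eq oU hZ IH (fun z _ => erefl)).
by rewrite !derive1nS E.
Qed.

Lemma derivn_rot U f (c : C) n : copen U -> hol U f ->
  (forall z, U z -> U (c * z)) -> forall z, U z ->
  (fun x => f (c * x))^`(n) z = c ^+ n * derive1n n f (c * z).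
Proof.
move=> oU hf Uc; elim: n => [|n IH] z Uz; first by rewrite expr0 mul1r.
have hn := hol_derivn n oU hf.
have hc := holoZ (c ^+ n) (holo_comp (holoZ c (holo_id U)) hn Uc).
have [_ E] := holo_hol oU (holo_eq oU hc IH (fun z _ => erefl)).
by rewrite !derive1nS E// mulr1 exprSr mulrA.
Qed.

End IteratedDerivatives.

(** * Families of holomorphic functions *)

Section Families.
Context {R : realType}.
Local Notation C := R[i].
Local Notation rc := (real_complex R).
Implicit Types (U : set C) (f : C -> C^o) (z w : C).

Lemma continuous_cabs_plane : continuous (fun xy : R * R => cabs (of_plane xy)).
Proof.
have -> : (fun xy : R * R => cabs (of_plane xy)) = (fun xy => Num.sqrt (xy.1 * xy.1 + xy.2 * xy.2)).
  by apply/funext => -[x y]; rewrite cabs_sqrt/= !expr2.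
move=> xy; apply: continuous_comp; last exact: sqrt_continuous.
by apply: cvgD; apply: cvgM; (exact: cvg_fst || exact: cvg_snd).
Qed.

Lemma compact_plane_ball r : compact [set xy : R * R | cabs (of_plane xy) <= r].
Proof.
apply: (@subclosed_compact _ _ (`[-r, r] `*` `[-r, r])).
- rewrite (_ : mkset _ = (fun xy : R * R => cabs (of_plane xy)) @^-1` [set x | x <= r]) //.
  apply: preimage_closed; last exact: closed_le.
  by move=> x _; exact: continuous_cabs_plane.
- by apply: compact_setX; exact: segment_compact.
- move=> [x y] /= H; rewrite !in_itv/= -!ler_norml.
  by split; rewrite (le_trans _ H)// ?(cabs_Re (of_plane (x, y))) ?(cabs_Im (of_plane (x, y))).
Qed.

Lemma of_planeK z : of_plane (complex.Re z, complex.Im z) = z.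
Proof. by case: z. Qed.

Lemma bounded_on_cball (G : C -> C) z r : (forall w, cball z r w -> ccont G w) ->
  exists B, forall w, cball z r w -> cabs (G w) <= B.
Proof.
move=> cG.
have /compact_near_coveringP/near_covering_withinP := @compact_plane_ball r.
move=> /(_ R (+oo%R) (fun B xy => cabs (G (z + of_plane xy)) <= B)); case.
  move=> [x y] /= xyr.
  have [|d d0 Hd] := cG (z + of_plane (x, y)) _ 1 ltr01.
    by rewrite /cball/= addrAC subrr add0r.
  have d2 : 0 < d / 2 by rewrite divr_gt0.
  exists ([set uv : R * R | `|x - uv.1| < d / 2 /\ `|y - uv.2| < d / 2],
    [set B | cabs (G (z + of_plane (x, y))) + 1 < B]) => /=.
    split; last first.
      exists (cabs (G (z + of_plane (x, y))) + 1); split; first exact: num_real.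
      by move=> B.
    exists (ball x (d / 2), ball y (d / 2)) => /=; last by move=> [u v].
    by split; exact: nbhsx_ballx.
  move=> [[u v] B] /= [[xu yv] GB] _.
  pose h := of_plane (u - x, v - y).
  have hd : cabs h <= d.
    rewrite (le_trans (cabs_le_ReIm _))//= [d]splitr lerD// distrC; exact: ltW.
  have -> : z + of_plane (u, v) = z + of_plane (x, y) + h.
    rewrite -addrA; congr (z + _); apply/eqP.
    by rewrite eq_complex/= [x + _]addrC [y + _]addrC !subrK !eqxx.
  have := Hd h hd; set w := z + _ => H.
  rewrite -[G _](subrK (G w)) (le_trans (cabsD _ _))// (le_trans _ (ltW GB))//.
  by rewrite addrC lerD2l.
move=> B [Br HB].
exists (B + 1) => w wz.
have := HB (B + 1) _ (complex.Re (w - z), complex.Im (w - z)).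
rewrite /= of_planeK [z + _]addrC subrK; apply; last exact: wz.
by rewrite ltrDl.
Qed.

(** Cauchy's estimate applied twice, on discs of half and of quarter radius. *)
Lemma taylor2_le U f z r B h : copen U -> hol U f -> 0 < r -> cball z r `<=` U ->
  (forall w, cball z r w -> cabs (f w) <= B) -> cabs h <= r / 4 ->
  cabs (f (z + h) - f z - h * derive1 f z) <= 32 * B / r ^+ 2 * cabs h ^+ 2.
Proof.
move=> oU hf r0 zU fB hr.
have hf' := hol_derive oU hf.
have f'B w : cball z (r / 2) w -> cabs (f^`() w) <= 4 * B / r.
  move=> wz; have -> : 4 * B / r = B / (r / 4) by field; rewrite gt_eqF.
  have wr (s : R) : s <= r / 2 -> cball w s `<=` cball z r.
    by move=> sr; apply: cball_sub; rewrite [r]splitr lerD.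
  have r4 : r / 4 < r / 2 by rewrite ltr_pM2l// ltf_pV2 ?posrE// ltr_nat.
  apply: (cauchy_estimate hf _ r4 (subset_trans (wr _ (lexx _)) zU)).
    by rewrite divr_gt0.
  by move=> x wx; apply: fB; apply: wr wx; exact: ltW.
have f''B w : cball z (r / 4) w -> cabs (f^`()^`() w) <= 32 * B / r ^+ 2.
  move=> wz; have -> : 32 * B / r ^+ 2 = 4 * B / r / (r / 8) by field; rewrite gt_eqF.
  have wr (s : R) : s <= r / 4 -> cball w s `<=` cball z (r / 2).
    move=> sr; apply: cball_sub; rewrite (le_trans (lerD wz sr))//.
    by rewrite -mulrDr ler_pM2l// -[4]/(2 * 2)%:R natrM; lra.
  have r8 : r / 8 < r / 4 by rewrite ltr_pM2l// ltf_pV2 ?posrE// ltr_nat.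
  have zU' : cball z (r / 2) `<=` U.
    by apply: subset_trans zU => x; rewrite /cball/= => /le_trans; apply; rewrite ler_pdivrMr// ler_pMr// ler1n.
  apply: (cauchy_estimate hf' _ r8 (subset_trans (wr _ (lexx _)) zU')).
    by rewrite divr_gt0.
  by move=> x wx; apply: f'B; apply: wr wx; exact: ltW.
have seg (s : R) : 0 <= s <= 1 -> cabs (rc s * h) <= cabs h.
  by move=> /andP[s0 s1]; rewrite cabsM cabs_rc ger0_norm// ler_piMl ?cabs_ge0.
have segz (s : R) : 0 <= s <= 1 -> cball z (r / 4) (z + rc s * h).
  by move=> /seg H; rewrite /cball/= addrAC subrr add0r (le_trans H).
have r4r : cball z (r / 4) `<=` U.
  by apply: subset_trans zU => x; rewrite /cball/= => /le_trans; apply; rewrite ler_pdivrMr// ler_pMr// ler1n.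
have B0 : 0 <= 32 * B / r ^+ 2.
  by rewrite (le_trans (cabs_ge0 (f^`()^`() z)))// f''B// /cball/= subrr cabs0 divr_ge0// ltW.
rewrite expr2 mulrA; apply: (@taylor1_le _ f f^`()) => s s01.
  by apply: (hol_cderiv hf); exact/r4r/segz.
apply: (le_trans (@increment_le _ f^`() f^`()^`() z (rc s * h) (32 * B / r ^+ 2) _ _)).
- move=> t t01; apply: (hol_cderiv hf'); apply: r4r.
  rewrite mulrA -rmorphM; apply: segz.
  by move/andP: t01 s01 => [t0 t1] /andP[s0 s1]; rewrite mulr_ge0// mulr_ile1.
- move=> t t01; apply: f''B; rewrite mulrA -rmorphM; apply: segz.
  by move/andP: t01 s01 => [t0 t1] /andP[s0 s1]; rewrite mulr_ge0// mulr_ile1.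
- by rewrite ler_wpM2l// seg.
Qed.

Definition hol_family U (g : C -> R -> C^o) :=
  [/\ forall t, hol U (g ^~ t), forall w, U w -> forall t, rcont (g w) t &
   forall w, U w -> exists r B, [/\ 0 < r, cball w r `<=` U &
     forall x t, cball w r x -> cabs (g x t) <= B]].

(** Cauchy's estimates make the difference quotients converge uniformly in the
   parameter; so derivatives stay continuous in the parameter, and they can be
   taken under the integral sign. *)
Lemma hol_family_derive U g : copen U -> hol_family U g ->
  hol_family U (fun w t => (g ^~ t)^`() w) /\
  forall w, U w -> cderiv (fun w => cint (g w)) w
     (cint (fun t => (g ^~ t)^`() w)).
Proof.
move=> oU [hg cg bg].
have T w (Uw : U w) : exists r K, [/\ 0 < r, 0 < K & forall h t, cabs h <= r ->
   U (w + h) /\ cabs (g (w + h) t - g w t - h * derive1 (g ^~ t) w) <= K * cabs h ^+ 2].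
  have [r [B [r0 wU gB]]] := bg w Uw.
  have B0 : 0 <= B.
    by rewrite (le_trans (cabs_ge0 _) (gB w 0 _))// /cball/= subrr cabs0 ltW.
  exists (r / 4), (32 * B / r ^+ 2 + 1); split; first by rewrite divr_gt0.
    by rewrite ltr_wpDl// divr_ge0 ?mulr_ge0 ?exprn_ge0 ?(ltW r0).
  move=> h t hr; split.
    apply: wU; rewrite /cball/= addrAC subrr add0r (le_trans hr)//.
    by rewrite ler_pdivrMr// ler_pMr// ler1n.
  have := @taylor2_le U (g ^~ t) w r B h oU (hg t) r0 wU (fun x => gB x t) hr.
  by move=> /le_trans; apply; rewrite ler_wpM2r ?exprn_ge0 ?cabs_ge0// lerDl.
have c' w : U w -> forall t, rcont (fun t => (g ^~ t)^`() w) t.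
  move=> Uw t e e0; have [r [K [r0 K0 H]]] := T w Uw.
  (* A difference quotient of fixed step [d] approximates the derivative within
     [e / 4] at every [t], and it is continuous in [t]. *)
  pose d := Num.min r (e / 4 / K).
  have d0 : 0 < d by rewrite lt_min r0 !divr_gt0.
  have dd : cabs (rc d) = d by rewrite cabs_rc gtr0_norm.
  have dr : cabs (rc d) <= r by rewrite dd ge_min lexx.
  have dK : K * d <= e / 4 by rewrite mulrC -ler_pdivlMr// ge_min lexx orbT.
  have Q s : cabs (g (w + rc d) s - g w s - rc d * derive1 (g ^~ s) w) <= e / 4 * d.
    by have [_] := H (rc d) s dr; rewrite dd expr2 mulrA => /le_trans; apply; rewrite ler_pM2r.
  have [Uwd _] := H (rc d) 0 dr.
  have ed : 0 < e / 2 * d by rewrite mulr_gt0// divr_gt0.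
  have [q q0 Hq] := hcontB (cg _ Uwd t) (cg _ Uw t) ed.
  exists q => // h /Hq {}Hq; rewrite -(ler_pM2l d0) -{1}dd -cabsM.
  set X := (X in _ <= X).
  have I (a b a' b' u v k : C) : k * (u - v) =
    ((a - b) - (a' - b')) - (a - b - k * u) + (a' - b' - k * v) by ring.
  rewrite (I (g (w + rc d) (t + h)) (g w (t + h)) (g (w + rc d) t) (g w t)).
  rewrite (le_trans (cabsD _ _))// (le_trans (lerD (cabsD _ _) (lexx _)))// cabsN.
  rewrite (le_trans (lerD (lerD Hq (Q _)) (Q _)))// /X.
  by rewrite le_eqVlt; apply/orP; left; apply/eqP; field.
split; first split.
- by move=> t; exact: hol_derive.
- exact: c'.
- move=> w Uw; have [r [B [r0 wU gB]]] := bg w Uw.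
  have r2 : r / 2 < r by rewrite ltr_pdivrMr// ltr_pMr// ltr1n.
  have r4 : r / 4 < r / 2 by rewrite ltr_pM2l// ltf_pV2 ?posrE// ltr_nat.
  have wr x (s : R) : s <= r / 2 -> cball w (r / 2) x -> cball x s `<=` cball w r.
    by move=> sr xw; apply: cball_sub; rewrite [r]splitr lerD.
  exists (r / 2), (B / (r / 4)); split; first by rewrite divr_gt0.
    by apply: subset_trans wU => x; rewrite /cball/= => /le_trans; apply; exact: ltW.
  move=> x t xw.
  apply: (cauchy_estimate (hg t) _ r4 (subset_trans (wr x _ (lexx _) xw) wU)).
    by rewrite divr_gt0.
  by move=> y yx; apply: gB; apply: (wr x (r / 4) (ltW r4) xw).
move=> w Uw e e0; have [r [K [r0 K0 H]]] := T w Uw.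
have p0 : 0 < 2 * pi :> R by rewrite mulr_gt0// pi_gt0.
have k0 : 0 < K * (2 * pi) by rewrite mulr_gt0.
exists (Num.min r (e / (K * (2 * pi)))); first by rewrite lt_min r0 divr_gt0.
move=> h /=; rewrite le_min => /andP[hr he].
have Uwh : U (w + h) by have [] := H h 0 hr.
have c1 t : rcont (fun t => h * derive1 (g ^~ t) w) t.
  by apply: hcontM; [exact: hcont_cst|exact: c'].
have c2 t : rcont (fun t => g (w + h) t - g w t) t.
  by apply: hcontB; exact: cg.
rewrite -cintZ; last exact: c'.
rewrite -cintB; [|exact: cg|exact: cg].
rewrite -cintB//.
apply: (@le_trans _ _ (K * cabs h ^+ 2 * (2 * pi))).
  apply: cint_le => [t|t _]; first exact: hcontB (c2 t) (c1 t).
  by have [] := H h t hr.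
rewrite mulrAC expr2 mulrA ler_wpM2r ?cabs_ge0// mulrC -ler_pdivlMr//.
Qed.

Lemma hol_family_derivn U g n : copen U -> hol_family U g ->
  hol_family U (fun w t => (g ^~ t)^`(n) w).
Proof.
move=> oU hg; elim: n => [|n IH]; first exact: hg.
have [H _] := hol_family_derive oU IH; exact: H.
Qed.

Lemma hol_cint U g : copen U -> hol_family U g ->
  hol U (fun w => cint (g w) : C^o).
Proof.
move=> oU hg; have [h1 d1] := hol_family_derive oU hg.
have [_ d2] := hol_family_derive oU h1.
apply: (holo_hol oU _).1; split=> w Uw; first exact: d1.
exact: hderiv_cont (d2 w Uw).
Qed.

Lemma derivn_cint U g n w : copen U -> hol_family U g -> U w ->
  (fun w => cint (g w) : C^o)^`(n) w = cint (fun t => (g ^~ t)^`(n) w).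
Proof.
move=> oU hg; elim: n w => [|n IH] w Uw; first by [].
have hn := hol_family_derivn n oU hg.
have [_ dn] := hol_family_derive oU hn.
rewrite derive1nS.
have [_ ->] := hol_eq oU (hol_cint oU hn) IH; last exact: Uw.
exact: cderiv_derive1 (dn w Uw).
Qed.

End Families.

(** * Automorphisms of the disc *)

Section Moebius.
Context {R : realType}.
Local Notation C := R[i].
Local Notation rc := (real_complex R).
Implicit Types (U : set C) (F : C -> C^o) (a b z w : C).

Lemma cball0_disk (r : R) : r < 1 -> cball 0 r `<=` disk (R := R).
Proof. by move=> r1 z; rewrite /cball/= subr0 => /le_lt_trans; apply. Qed.

Lemma copen_disk : copen (disk (R := R)).
Proof.
move=> z; rewrite {1}/disk/= => z1; exists ((1 - cabs z) / 2); first by rewrite divr_gt0// subr_gt0.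
move=> w; rewrite /cball/disk/= => wz.
have := cabsD (w - z) z; rewrite subrK; move: wz z1; lra.
Qed.

Lemma disk0 : disk (0 : C).
Proof. by rewrite /disk/= cabs0. Qed.

Lemma sigmaE a z : sigma a z = (a - z) / (1 - a^*%C * z). Proof. by []. Qed.

Lemma sigma_den_neq0 a z : disk a -> disk z -> 1 - a^*%C * z != 0.
Proof.
rewrite /disk/= => a1 z1; rewrite -cabs_gt0.
have az : cabs (a^*%C * z) < 1.
  by rewrite cabsM cabs_conj mulr_ilt1// cabs_ge0.
have := cabsD (1 - a^*%C * z) (a^*%C * z); rewrite subrK cabs1 -lerBlDr.
by apply: lt_le_trans; rewrite subr_gt0.
Qed.

Lemma disk_sqr z : disk z = (cabs z ^+ 2 < 1) :> Prop.
Proof. by rewrite /disk/= expr_lt1// cabs_ge0. Qed.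

Lemma sigma_den_sqr a z :
  cabs (1 - a^*%C * z) ^+ 2 - cabs (a - z) ^+ 2 =
  (1 - cabs a ^+ 2) * (1 - cabs z ^+ 2).
Proof. by rewrite !cabs_sqr; case: a z => a1 a2 [z1 z2] /=; ring. Qed.

Lemma one_sub_sigma_sqr a z : disk a -> disk z ->
  1 - cabs (sigma a z) ^+ 2 =
  (1 - cabs a ^+ 2) * (1 - cabs z ^+ 2) / cabs (1 - a^*%C * z) ^+ 2.
Proof.
move=> a1 z1; rewrite -sigma_den_sqr sigmaE cabsM cabsV exprMn exprVn.
have := sigma_den_neq0 a1 z1; rewrite -cabs_eq0 => d0.
by field.
Qed.

Lemma disk_sigma a z : disk a -> disk z -> disk (sigma a z).
Proof.
move=> a1 z1; rewrite disk_sqr -subr_gt0 one_sub_sigma_sqr//.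
move: (a1) (z1); rewrite !disk_sqr => a2 z2.
by rewrite divr_gt0 ?mulr_gt0 ?subr_gt0// cabs_gt0 sigma_den_neq0.
Qed.

Definition sigma' a z : C := - rc (1 - cabs a ^+ 2) / (1 - a^*%C * z) ^+ 2.

Lemma holo_sigma a : disk a -> holo (disk (R := R)) (sigma a) (sigma' a).
Proof.
move=> a1.
have h1 := holoD (holo_cst (disk (R := R)) a) (holoZ (-1) (holo_id (disk (R := R)))).
have h2 := holoD (holo_cst (disk (R := R)) 1) (holoZ (- a^*%C) (holo_id (disk (R := R)))).
have h3 : forall z, disk z -> 1 + - a^*%C * z != 0.
  by move=> z z1; rewrite mulNr; exact: sigma_den_neq0.
apply: (holo_eq copen_disk (holoM h1 (holo_inv h2 h3))) => z z1.
  by rewrite sigmaE mulN1r mulNr.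
have E : rc (1 - cabs a ^+ 2) = 1 - a^*%C * a by rewrite conj_mul rmorphB rmorph1.
rewrite /sigma' E.
have d0 := h3 z z1; have d1 := sigma_den_neq0 a1 z1.
by rewrite !add0r !mulNr; field; rewrite d1.
Qed.

Lemma hol_comp_sigma F a : disk a -> hol (disk (R := R)) F ->
  hol (disk (R := R)) (F \o sigma a) /\
  forall z, disk z -> (F \o sigma a)^`() z = sigma' a z * derive1 F (sigma a z).
Proof.
move=> a1 hF; apply: (holo_hol copen_disk).
by apply: (holo_comp (holo_sigma a1) hF) => z; exact: disk_sigma.
Qed.

(** Equality in the Schwarz-Pick lemma: the hyperbolic derivative of an
   automorphism is one. *)
Lemma cabs_sigma' a z : disk a -> disk z ->
  (1 - cabs z ^+ 2) * cabs (sigma' a z) = 1 - cabs (sigma a z) ^+ 2.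
Proof.
move=> a1 z1; rewrite one_sub_sigma_sqr// /sigma' cabsM cabsV cabsX cabsN cabs_rc.
rewrite ger0_norm; first by ring.
by move: a1; rewrite disk_sqr subr_ge0 => /ltW.
Qed.

(** The rotation factor is explicit because [n]th derivatives at the origin have
   to be seen to change only by a factor of modulus one. *)
Lemma sigma_comp a b z : disk a -> disk b -> disk z ->
  sigma a (sigma b z) =
  sigma (sigma a b) (- (1 - a * b^*%C) / (1 - a^*%C * b) * z).
Proof.
move=> a1 b1 z1.
have ab : 1 - a^*%C * b != 0 by exact: sigma_den_neq0.
have ba : 1 - a * b^*%C != 0 by rewrite mulrC; exact: sigma_den_neq0.
have bz : 1 - b^*%C * z != 0 by exact: sigma_den_neq0.
have d1 : 1 - a^*%C * sigma b z != 0 by apply: sigma_den_neq0 => //; exact: disk_sigma.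
have E : (1 - a^*%C * sigma b z) * (1 - b^*%C * z) =
    1 - b^*%C * z - a^*%C * (b - z) by rewrite sigmaE; field.
have d2 : 1 - b^*%C * z - a^*%C * (b - z) != 0 by rewrite -E mulf_neq0.
transitivity ((a - sigma b z) / (1 - a^*%C * sigma b z)); first by [].
set c := sigma a b; rewrite [RHS]sigmaE.
have -> : c^*%C = (a^*%C - b^*%C) / (1 - a * b^*%C).
  by rewrite /c !sigmaE rmorphM fmorphV !rmorphB rmorph1 rmorphM/= conjcK.
have -> : 1 - (a^*%C - b^*%C) / (1 - a * b^*%C) * (- (1 - a * b^*%C) / (1 - a^*%C * b) * z)
   = (1 - b^*%C * z - a^*%C * (b - z)) / (1 - a^*%C * b).
  by field; rewrite ba ab.
have -> : 1 - a^*%C * sigma b z = (1 - b^*%C * z - a^*%C * (b - z)) / (1 - b^*%C * z).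
  by rewrite -E mulfK.
by rewrite /c !sigmaE; field; rewrite ab bz d2.
Qed.

Lemma cabs_rotation a b : disk a -> disk b ->
  cabs (- (1 - a * b^*%C) / (1 - a^*%C * b)) = 1.
Proof.
move=> a1 b1; rewrite cabsM cabsV cabsN.
rewrite -(cabs_conj (1 - a * b^*%C)) rmorphB rmorph1 rmorphM/= conjcK.
by rewrite divff// cabs_eq0 sigma_den_neq0.
Qed.

Lemma rotate_sigma (s t : R) w :
  expi t * sigma (rc s) w = sigma (expi t * rc s) (expi t * w).
Proof.
have E : (expi t * rc s)^*%C * (expi t * w) = (rc s)^*%C * w.
  have I (p q r u : C) : p * q * (r * u) = p * r * (q * u) by ring.
  by rewrite (rmorphM conjc) I conj_mul cabs_expi expr1n mul1r.
by rewrite !sigmaE E mulrA mulrBr.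
Qed.

Lemma holo_invX (s : C) m : disk s ->
  holo (disk (R := R)) (fun w => (1 - s^*%C * w) ^- m)
   (fun w => m%:R * s^*%C * (1 - s^*%C * w) ^- m.+1).
Proof.
move=> s1; have d0 w : disk w -> 1 + - s^*%C * w != 0.
  by move=> w1; rewrite mulNr sigma_den_neq0.
have h2 := holo_inv (holoD (holo_cst (disk (R := R)) 1)
  (holoZ (- s^*%C) (holo_id (disk (R := R))))) d0.
elim: m => [|m IH].
  by apply: (holo_eq copen_disk (holo_cst _ 1)) => w _; rewrite ?expr0 ?invr1// !mul0r.
apply: (holo_eq copen_disk (holoM h2 IH)) => w w1.
  by rewrite exprS invfM mulNr.
have := d0 w w1; rewrite mulNr; set d := 1 - _ => dn.
rewrite add0r mulr1 !exprS expr0 mulr1 -natr1 !invfM.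
have dm : d ^+ m != 0 by rewrite expf_neq0.
by field; rewrite dn dm.
Qed.

Lemma derivn_sigma (a : C) n w : disk a -> disk w ->
  derive1n n.+1 (sigma a : C -> C^o) w =
  - rc (1 - cabs a ^+ 2) * (n.+1)`!%:R * a^*%C ^+ n * (1 - a^*%C * w) ^- n.+2.
Proof.
move=> a1; elim: n w => [|n IH] w w1.
  have [_ E] := holo_hol copen_disk (holo_sigma a1 : holo _ (sigma a : C -> C^o) _).
  by rewrite /derive1n/= E// /sigma' expr0 !mulr1.
rewrite derive1nS.
pose c : C := - rc (1 - cabs a ^+ 2) * (n.+1)`!%:R * a^*%C ^+ n.
have [_ ->//] := holo_hol copen_disk (holo_eq copen_disk (holoZ c (holo_invX n.+2 a1)) IH (fun z _ => erefl)).
have I (u f k x y d : C) : u * f * y * (k * x * d) = u * (k * f) * (x * y) * d.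
  by ring.
by rewrite /c [(n.+2)`!]factS natrM [a^*%C ^+ n.+1]exprS I.
Qed.

Lemma midpoint_to1 (x : R) : x < 1 ->
  [/\ (1 + x) / 2 < 1, 0 < (1 + x) / 2 - x, 1 + x < 2 & x * 2 < 1 + x].
Proof. by move=> x1; split; lra. Qed.

(** Averaging [conj(e^it) G (e^it sigma_s w)] over the circle projects
   [G = F o sigma_a] on its linear Taylor term and leaves [G' 0 * sigma_s w]; by
   the composition law the averaged functions are rotated copies of the
   [F o sigma_c], whose [n]th derivatives at the origin are controlled. *)
Lemma bloch_of_derivn F n M : hol (disk (R := R)) F ->
  (forall c, disk c -> cabs ((F \o sigma c)^`(n.+1) 0) <= M) ->
  exists B, forall a, disk a -> (1 - cabs a ^+ 2) * cabs (F^`() a) <= B.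
Proof.
move=> hF FM.
(* Any [s] in ]0, 1[ would do: [s <> 0] makes the derivatives of [sigma s] of all
   positive orders nonzero at the origin. *)
pose s := rc 2^-1; have s1 : disk s.
  by rewrite /disk/= cabs_rc ger0_norm ?invr_ge0// invf_lt1// ltr1n.
pose k := cabs (derive1n n.+1 (sigma s : C -> C^o) 0).
have k0 : 0 < k.
  rewrite /k cabs_gt0 derivn_sigma//; last exact: disk0.
  rewrite mulr0 subr0 expr1n invr1 mulr1 !mulf_neq0//.
  - rewrite oppr_eq0; apply: rc_neq0; rewrite gt_eqF// subr_gt0.
    by have := s1; rewrite disk_sqr.
  - by rewrite expf_neq0// conjc_real; apply: rc_neq0; rewrite invr_eq0 pnatr_eq0.
exists (M / k) => a a1; rewrite ler_pdivlMr//.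
have [hG GE] := hol_comp_sigma a1 hF; set G := F \o sigma a in hG GE.
have G0 : cabs (G^`() 0) = (1 - cabs a ^+ 2) * cabs (F^`() a).
  rewrite GE; last exact: disk0.
  rewrite /sigma' sigmaE !mulr0 !subr0 expr1n !divr1 cabsM cabsN cabs_rc ger0_norm//.
  by move: a1; rewrite disk_sqr subr_ge0 => /ltW.
rewrite -G0.
have rotU (e : C) z : cabs e = 1 -> disk z -> disk (e * z).
  by move=> e1; rewrite /disk/= cabsM e1 mul1r.
pose g w t := (expi t)^-1 * G (expi t * sigma s w) : C^o.
have hs := holo_sigma s1.
have hg t : hol (disk (R := R)) (g ^~ t).
  have H := holoZ (expi t)^-1 (holo_comp (holoZ (expi t) hs) hG
    (fun z zd => rotU _ _ (cabs_expi t) (disk_sigma s1 zd))).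
  exact: (holo_hol copen_disk (H : holo _ (g ^~ t) _)).1.
have fam : hol_family (disk (R := R)) g.
  split => //.
    move=> w w1 t; apply: hcontM; first exact: rcont_expiV.
    apply: (hcont_comp (hcontM (rcont_expi t) (hcont_cst _ (sigma s w) t))).
    by apply: (holo_cont hG); apply: rotU (disk_sigma s1 w1); exact: cabs_expi.
  move=> w w1; pose rho := (1 + cabs (sigma s w)) / 2.
  have sw1 : cabs (sigma s w) < 1 by exact: disk_sigma.
  have [rho1 rs _ _] := midpoint_to1 sw1; rewrite -/rho in rho1 rs.
  have [d d0 Hd] := holo_cont hs w1 rs.
  have [r r0 wr] := copen_disk w1.
  have [B HB] := @bounded_on_cball _ G 0 rho (fun x xr => holo_cont hG (cball0_disk rho1 xr)).
  exists (Num.min d r), B; split; first by rewrite lt_min d0.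
    by apply: subset_trans wr => x; rewrite /cball/= le_min => /andP[].
  move=> x t; rewrite /cball/= le_min => /andP[xd _].
  rewrite /g cabsM cabs_expiV mul1r; apply: HB.
  rewrite /cball/= subr0 cabsM cabs_expi mul1r.
  have := Hd (x - w) xd; rewrite [w + _]addrC subrK => H.
  rewrite -[sigma s x](subrK (sigma s w)) (le_trans (cabsD _ _))//.
  by rewrite -lerBrDr.
have mean w : disk w -> cint (g w) = rc (2 * pi) * derive1 G 0 * sigma s w.
  move=> w1; set zeta := sigma s w.
  have z1 : cabs zeta < 1 by exact: disk_sigma.
  have zp : 0 < 1 + cabs zeta by rewrite ltr_wpDr ?cabs_ge0.
  (* [1 < r' < 1 / |zeta|], with no exception at [zeta = 0]. *)
  pose r' := 2 / (1 + cabs zeta).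
  have [_ _ z2 z3] := midpoint_to1 z1.
  have r'1 : 1 < r' by rewrite ltr_pdivlMr// mul1r.
  have r'U : cball 0 r' `<=` [set x : C | disk (zeta * x)].
    move=> x; rewrite /cball/disk/= subr0 cabsM => xr.
    rewrite (le_lt_trans (ler_wpM2l (cabs_ge0 _) xr))// mulrA ltr_pdivrMr//.
    by rewrite mul1r.
  have h1 := holo_comp (holoZ zeta (holo_id [set x : C | disk (zeta * x)])) hG (fun z H => H).
  have := circle_moment h1 ltr01 r'1 r'U.
  rewrite rmorph1 mul1r mulr0 mulr1 [zeta * _]mulrC mulrA => <-.
  apply: cint_ext => t; rewrite /g /circle rmorph1 mul1r add0r [zeta * _]mulrC.
  by [].
have gn t : cabs ((g ^~ t)^`(n.+1) 0) <= M.
  pose b := expi t * s.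
  have b1 : disk b by apply: rotU => //; exact: cabs_expi.
  pose eta := - (1 - a * b^*%C) / (1 - a^*%C * b) * expi t.
  have eta1 : cabs eta = 1 by rewrite cabsM cabs_rotation// cabs_expi mulr1.
  have c1 := disk_sigma a1 b1.
  have [hc _] := hol_comp_sigma c1 hF.
  pose f1 x := (F \o sigma (sigma a b)) (eta * x) : C^o.
  have hf1 : hol (disk (R := R)) f1.
    have H := holo_comp (holoZ eta (holo_id (disk (R := R)))) hc (fun z zd => rotU _ _ eta1 zd).
    exact: (holo_hol copen_disk (H : holo _ f1 _)).1.
  have gf x : disk x -> g x t = (expi t)^-1 * f1 x.
    move=> x1; rewrite /g /f1 /G /eta /= rotate_sigma sigma_comp//; last first.
      by apply: rotU => //; exact: cabs_expi.
    by congr (_ * F (sigma _ _)); exact: mulrA.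
  have hgf := holoZ (expi t)^-1 hf1.
  have [hgf' _] := holo_hol copen_disk (hgf : holo _ (fun x => (expi t)^-1 * f1 x : C^o) _).
  rewrite (derivn_eq n.+1 copen_disk hgf' gf disk0).
  rewrite (derivnZ _ n.+1 copen_disk hf1 disk0) cabsM cabs_expiV mul1r.
  rewrite (derivn_rot n.+1 copen_disk hc (fun z zd => rotU _ _ eta1 zd) disk0).
  by rewrite cabsM cabsX eta1 expr1n mul1r mulr0 FM.
have p0 : 0 < 2 * pi :> R by rewrite mulr_gt0// pi_gt0.
have [hs' _] := holo_hol copen_disk (hs : holo _ (sigma s : C -> C^o) _).
have hZ := (holo_hol copen_disk (holoZ (rc (2 * pi) * derive1 G 0) hs' :
  holo _ (fun x => rc (2 * pi) * derive1 G 0 * sigma s x : C^o) _)).1.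
have := derivn_cint n.+1 copen_disk fam disk0.
rewrite (derivn_eq n.+1 copen_disk hZ mean disk0).
rewrite (derivnZ _ n.+1 copen_disk hs' disk0) => E.
have {E} : cabs (rc (2 * pi) * derive1 G 0) * k = cabs (cint (fun t => (g ^~ t)^`(n.+1) 0)).
  by rewrite -E -cabsM.
rewrite cabsM cabs_rc gtr0_norm// -mulrA => E.
rewrite -(ler_pM2l p0) E [leRHS]mulrC; apply: cint_le => [t|t _]; last exact: gn.
have [_ + _] := hol_family_derivn n.+1 copen_disk fam.
by move=> /(_ 0 disk0 t).
Qed.

End Moebius.

(** * From area integrals to point values *)

Section AreaLowerBound.
Context {R : realType}.
Local Notation C := R[i].
Local Notation rc := (real_complex R).
Local Notation leb2 := ((@lebesgue_measure R) \x (@lebesgue_measure R))%E.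
Implicit Types (z w : C).

(** The integral of a nonnegative function is a supremum over simple functions
   below it, hence monotone even on non-measurable functions. *)
Lemma ge0_le_integral_any d (T : measurableType d) (mu : {measure set T -> \bar R})
    (D : set T) (f g : T -> \bar R) :
  (forall x, D x -> (0 <= f x)%E) -> (forall x, D x -> (f x <= g x)%E) ->
  (\int[mu]_(x in D) f x <= \int[mu]_(x in D) g x)%E.
Proof.
move=> f0 fg; have g0 x : D x -> (0 <= g x)%E.
  by move=> Dx; exact: le_trans (f0 x Dx) (fg x Dx).
rewrite !ge0_integralE//; apply: le_ereal_sup => _ [h /= hf <-].
exists h => // x; apply: le_trans (hf x) _; exact: lee_restrict.
Qed.

Lemma integral_ge_on_subset d (T : measurableType d) (mu : {measure set T -> \bar R})
    (D S : set T) (f : T -> \bar R) (c : R) : measurable S -> S `<=` D -> 0 <= c ->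
  (forall x, D x -> (0 <= f x)%E) -> (forall x, S x -> (c%:E <= f x)%E) ->
  (c%:E * mu S <= \int[mu]_(x in D) f x)%E.
Proof.
move=> mS SD c0 f0 cf.
have SDS : D `&` S = S by rewrite setIC; exact/setIidPl.
rewrite -(integral_cst mu mS c%:E) -{1}SDS integral_mkcondr.
apply: ge0_le_integral_any => x Dx; rewrite patchE; case: ifPn => [xS|_] //.
- by apply: cf; move: xS; rewrite inE.
- exact: f0.
Qed.

Definition square z (d : R) : set (R * R) :=
  `[complex.Re z - d, complex.Re z + d] `*` `[complex.Im z - d, complex.Im z + d].

Lemma measurable_square z d : measurable (square z d).
Proof. by apply: measurableX; exact: measurable_itv. Qed.

Lemma square_measure z d : 0 < d -> leb2 (square z d) = (4 * d ^+ 2)%:E.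
Proof.
move=> d0; rewrite /square product_measure1E; [|exact: measurable_itv..].
have I (x : R) : lebesgue_measure (`[x - d, x + d] : set R) = (2 * d)%:E.
  rewrite lebesgue_measure_itv/= lte_fin ifT; last by rewrite ltrBlDr -addrA ltrDl addr_gt0.
  by rewrite -EFinB; congr _%:E; ring.
transitivity ((2 * d)%:E * (2 * d)%:E)%E; first by congr (_ * _)%E; exact: I.
by rewrite -EFinM; congr _%:E; ring.
Qed.

Lemma square_cball z d (xy : R * R) : square z d xy -> cball z (2 * d) (of_plane xy).
Proof.
case: xy => x y [/=]; rewrite !in_itv/= -!ler_distlC => hx hy.
rewrite /cball/= (le_trans (cabs_le_ReIm _))// mulr_natl mulr2n.
by case: z hx hy => a b /= hx hy; rewrite distrC lerD// distrC.
Qed.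

Lemma midpoint_radius (x r : R) : 2^-1 - x = 2 * r -> 2^-1 - r = x + r.
Proof. lra. Qed.

Lemma one_le_2powR (b : R) : 0 <= b -> 1 <= 2 `^ b :> R.
Proof.
by move=> b0; have := @ler_powR R 2 (ler1n _ 2) _ _ b0; rewrite powRr0.
Qed.

Lemma half_le (x y v : R) : x <= v + y -> v <= x / 2 -> x <= y + y.
Proof. lra. Qed.

Lemma two_le_mul16 (x : R) : 1 <= x -> 2 <= 16 * x.
Proof. lra. Qed.

Lemma one_le_mul16 (x : R) : 1 <= x -> 1 <= 16 * x.
Proof. lra. Qed.

(** At a point that nearly maximizes [(1/2 - |z|)^beta |F z|], the modulus is
   controlled on a whole neighbourhood, so Cauchy's estimate keeps it at least
   half its size on a disc of radius proportional to [1/2 - |z|].  This does the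
   work of subharmonicity of [|F|^p], for all [p > 0] at once. *)
Lemma large_disc (F : C -> C) F' (beta : R) : 0 < beta ->
  holo (disk (R := R)) F F' -> F 0 != 0 ->
  exists z r, [/\ 0 < r, cball z r `<=` cball 0 2^-1,
    2^-1 `^ beta * cabs (F 0) <= 2 * ((2 * r) `^ beta * cabs (F z)) &
    forall w, cball z (r / (16 * 2 `^ beta)) w -> cabs (F z) <= 2 * cabs (F w)].
Proof.
move=> b0 hF F0.
have half1 : 2^-1 < 1 :> R by rewrite invf_lt1// ltr1n.
have cF w : cball 0 2^-1 w -> ccont F w.
  by move=> wh; apply: (holo_cont hF); exact: cball0_disk half1 _ wh.
have [B HB] := bounded_on_cball cF.
pose W w := (2^-1 - cabs w) `^ beta * cabs (F w).
pose E := [set W w | w in cball 0 2^-1].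
have in0 : cball 0 2^-1 (0 : C) by rewrite /cball/= subrr cabs0 invr_ge0.
have W0 : W 0 = 2^-1 `^ beta * cabs (F 0) by rewrite /W cabs0 subr0.
have W0p : 0 < W 0 by rewrite W0 mulr_gt0 ?powR_gt0 ?invr_gt0// cabs_gt0.
have supE : has_sup E.
  split; first by exists (W 0), 0.
  exists (2^-1 `^ beta * B) => _ [w wh <-]; rewrite /W.
  apply: ler_pM; [exact: powR_ge0|exact: cabs_ge0| |exact: HB].
  move: wh; rewrite /cball/= subr0 => wh.
  apply: ge0_ler_powR; first exact: ltW.
  - by rewrite nnegrE subr_ge0.
  - by rewrite nnegrE invr_ge0.
  - by rewrite gerBl cabs_ge0.
have WS w : cball 0 2^-1 w -> W w <= sup E.
  by move=> wh; apply: ub_le_sup; [exact: supE.2|exists w].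
have S0 : 0 < sup E by apply: lt_le_trans W0p (WS _ in0).
have S2 : 0 < sup E / 2 by rewrite divr_gt0.
have [_ [z zh <-] Wz] := sup_adherent S2 supE.
have {}Wz : sup E < 2 * W z.
  by move: Wz; rewrite {1}(splitr (sup E)) addrK ltr_pdivrMr// mulrC.
have Wz0 : 0 < W z by rewrite -(pmulr_rgt0 _ (ltr0n R 2)) (lt_trans S0).
have zlt : cabs z < 2^-1.
  move: zh; rewrite /cball/= subr0 le_eqVlt => /orP[/eqP zE|//].
  by move: Wz0; rewrite /W zE subrr powR0 ?gt_eqF// mul0r ltxx.
have Fz0 : 0 < cabs (F z).
  by move: Wz0; rewrite /W pmulr_rgt0// powR_gt0 ?subr_gt0.
(* Half the distance to the circle: on [cball z r] the weight is at least
   [r ^ beta], while at [z] it is [(2 r) ^ beta]. *)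
pose r := (2^-1 - cabs z) / 2.
have r0 : 0 < r by rewrite divr_gt0 ?subr_gt0.
have rE : 2^-1 - cabs z = 2 * r by rewrite /r mulrC divfK.
have rE' : 2^-1 - r = cabs z + r by exact: midpoint_radius.
have zr : cball z r `<=` cball 0 2^-1.
  apply: cball_sub; rewrite subr0 -rE' gerBl; exact: ltW.
exists z, r; split => //.
  by rewrite -W0 -rE (le_trans (WS _ in0))// ltW.
have two0 : 0 < 2 `^ beta :> R by rewrite powR_gt0.
pose K := 2 * 2 `^ beta : R.
have K0 : 0 < K by rewrite mulr_gt0.
have FK w : cball z r w -> cabs (F w) <= K * cabs (F z).
  move=> wz; have wh := zr _ wz.
  have wr : r <= 2^-1 - cabs w.
    rewrite lerBrDr addrC -lerBrDr rE'.
    move: wz; rewrite /cball/= => wz.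
    by rewrite -[w](subrK z) (le_trans (cabsD _ _))// addrC lerD2l.
  have rb : 0 < r `^ beta by rewrite powR_gt0.
  rewrite -(ler_pM2l rb).
  apply: (@le_trans _ _ (W w)).
    rewrite /W ler_wpM2r ?cabs_ge0//; apply: ge0_ler_powR => //; first exact: ltW.
    - by rewrite nnegrE ltW.
    - by rewrite nnegrE (le_trans (ltW r0)).
  rewrite (le_trans (WS _ wh))// (le_trans (ltW Wz))// /W rE powRM ?(ltW r0)//.
  by rewrite le_eqVlt; apply/orP; left; apply/eqP; rewrite /K; ring.
have F'K w : cball z (r / 2) w -> cabs (F' w) <= 4 * K * cabs (F z) / r.
  move=> wz; rewrite (_ : _ / r = K * cabs (F z) / (r / 4)); last by field; rewrite gt_eqF.
  have r42 : r / 4 < r / 2 by rewrite ltr_pM2l// ltf_pV2 ?posrE// ltr_nat.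
  have wr : cball w (r / 2) `<=` cball z r.
    by apply: cball_sub; rewrite [leRHS]splitr lerD2r.
  apply: (cauchy_estimate hF _ r42).
  - by rewrite divr_gt0.
  - exact: subset_trans wr (subset_trans zr (cball0_disk half1)).
  - move=> x xw; apply/FK/wr; move: xw; rewrite /cball/= => /le_trans; apply.
    exact: ltW.
move=> w; rewrite /cball/= => wz.
have d2 : r / (16 * 2 `^ beta) <= r / 2.
  rewrite ler_pM2l// lef_pV2 ?posrE ?mulr_gt0//.
  by apply: two_le_mul16; apply: one_le_2powR; exact: ltW.
have seg (s : R) : 0 <= s <= 1 -> cball z (r / 2) (z + rc s * (w - z)).
  move=> /andP[s0 s1]; rewrite /cball/= addrAC subrr add0r cabsM cabs_rc ger0_norm//.
  by rewrite (le_trans _ d2)// (le_trans _ wz)// ler_piMl ?cabs_ge0.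
have r2r : cball z (r / 2) `<=` disk (R := R).
  apply: subset_trans (cball0_disk half1); apply: subset_trans zr => x.
  by rewrite /cball/= => /le_trans; apply; rewrite ler_pdivrMr// ler_pMr// ler1n.
have := @increment_le _ F F' z (w - z) (4 * K * cabs (F z) / r)
  (fun s s01 => hF.1 _ (r2r _ (seg s s01))) (fun s s01 => F'K _ (seg s s01)).
rewrite [z + _]addrC subrK => inc.
have {}inc : cabs (F w - F z) <= cabs (F z) / 2.
  rewrite (le_trans inc)//.
  have c0 : 0 <= 4 * K * cabs (F z) / r.
    by rewrite divr_ge0 ?(ltW r0)// mulr_ge0 ?cabs_ge0// mulr_ge0// ltW.
  rewrite (le_trans (ler_wpM2l c0 wz))// le_eqVlt; apply/orP; left; apply/eqP.
  by rewrite /K; field; rewrite !gt_eqF.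
have := cabsD (F z - F w) (F w); rewrite subrK cabsB => H.
by rewrite mulr_natl mulr2n; exact: half_le H inc.
Qed.

(** The minimum covers both signs of [alpha]. *)
Lemma weight_ge (alpha : R) : exists2 c, 0 < c &
  forall z, cball 0 2^-1 z -> c <= (1 - cabs z ^+ 2) `^ alpha.
Proof.
exists (Num.min 1 ((3 / 4) `^ alpha)); first by rewrite lt_min ltr01 powR_gt0// divr_gt0.
move=> z; rewrite /cball/= subr0 => zh.
have z0 := cabs_ge0 z.
have t1 : 1 - cabs z ^+ 2 <= 1 by rewrite gerBl sqr_ge0.
have t0 : 3 / 4 <= 1 - cabs z ^+ 2.
  have : cabs z ^+ 2 <= 2^-1 ^+ 2 by rewrite ler_sqr ?nnegrE ?invr_ge0.
  by rewrite (_ : 2^-1 ^+ 2 = 1 / 4 :> R); [lra|field].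
have tp : 0 < 1 - cabs z ^+ 2 by apply: lt_le_trans t0; rewrite divr_gt0.
rewrite ge_min; have [a0|a0] := leP 0 alpha; apply/orP; [right|left].
  by apply: ge0_ler_powR => //; rewrite nnegrE ?divr_ge0// ltW.
rewrite -[leLHS](powRr0 (1 - cabs z ^+ 2)); apply: ger_powR (ltW a0).
by rewrite tp t1.
Qed.

(** The disc of [large_disc] contributes a multiple of [|F z|^p r^2] to the
   integral; with [beta = 2 / p] this is [((r^beta) |F z|)^p], which dominates
   [|F 0|^p]. *)
Lemma value0_le_of_area_integral (p alpha M : R) : 0 < p -> exists B, forall (F : C -> C^o) psi,
  hol (disk (R := R)) F -> (forall z, disk z -> cabs (F z) <= psi z) ->
  (area_integral (fun z => (psi z `^ p * (1 - cabs z ^+ 2) `^ alpha)%R) <= M%:E)%E ->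
  cabs (F 0) <= B.
Proof.
move=> p0; pose beta := 2 / p; have b0 : 0 < beta by rewrite divr_gt0.
have [c c0 cw] := weight_ge alpha.
have two0 : 0 < 2 `^ beta :> R by rewrite powR_gt0.
have h0 : 0 < 2^-1 `^ beta :> R by rewrite powR_gt0// invr_gt0.
(* A square of half-side [d] lies in the disc of radius [2 d]; hence half of the
   radius given by [large_disc]. *)
pose k := (16 * 2 `^ beta)^-1 / 2 : R.
have k0 : 0 < k by rewrite divr_gt0// invr_gt0 mulr_gt0.
pose Q := (2 `^ p * 2 `^ p) * (M * pi / (c * k ^+ 2)).
exists (Q `^ p^-1 / 2^-1 `^ beta) => F psi hF Fpsi HM.
have half1 : 2^-1 < 1 :> R by rewrite invf_lt1// ltr1n.
have [->|F0] := eqVneq (F 0) 0; first by rewrite cabs0 divr_ge0 ?powR_ge0.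
have [z [r [r0 zr Fz Fw]]] := large_disc b0 hF F0.
pose m := cabs (F z).
have m0 : 0 <= m by exact: cabs_ge0.
pose d := r * k.
have d0 : 0 < d by rewrite mulr_gt0.
have dE : 2 * d = r / (16 * 2 `^ beta) by rewrite /d /k; field; rewrite gt_eqF.
have dr : 2 * d <= r.
  rewrite dE ler_pdivrMr ?mulr_gt0// ler_pMr//.
  by apply: one_le_mul16; apply: one_le_2powR; exact: ltW.
have SD xy : square z d xy -> cball 0 2^-1 (of_plane xy).
  move=> /square_cball H; apply: zr; move: H; rewrite /cball/= => /le_trans; apply.
  exact: dr.
have := HM; rewrite /area_integral => {}HM.
have L : ((c * (m / 2) `^ p)%:E * leb2 (square z d) <=
   \int[leb2]_(xy in plane_disk (R := R)) ((psi (of_plane xy)) `^ p * (1 - cabs (of_plane xy) ^+ 2) `^ alpha)%R%:E)%E.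
  apply: integral_ge_on_subset.
  - exact: measurable_square.
  - by move=> xy /SD; exact: cball0_disk.
  - by rewrite mulr_ge0 ?powR_ge0// ltW.
  - by move=> xy _; rewrite lee_fin mulr_ge0 ?powR_ge0.
  move=> xy Sxy; have wh := SD _ Sxy; rewrite lee_fin mulrC ler_pM ?powR_ge0 ?(ltW c0)//; last exact: cw.
  have Fpos := cabs_ge0 (F (of_plane xy)).
  have mp : m / 2 <= psi (of_plane xy).
    rewrite (le_trans _ (Fpsi _ _))//; last exact: cball0_disk half1 _ wh.
    rewrite ler_pdivrMr// mulrC; apply: Fw; rewrite -dE; exact: square_cball.
  apply: ge0_ler_powR => //; first exact: ltW.
  - by rewrite nnegrE divr_ge0.
  - by rewrite nnegrE (le_trans _ mp)// divr_ge0.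
rewrite square_measure// -EFinM in L.
have pi0 : 0 < pi :> R := pi_gt0 R.
have {L}HL : c * (m / 2) `^ p * (4 * d ^+ 2) <= M * pi.
  rewrite -ler_pdivrMr// mulrC -lee_fin (le_trans _ HM)// EFinM.
  by rewrite lee_pmul2l// ?lte_fin ?invr_gt0.
have mE : ((2 * r) `^ beta * m) `^ p = m `^ p * (4 * r ^+ 2).
  rewrite powRM ?powR_ge0// -powRrM /beta divfK ?gt_eqF// mulrC.
  congr (_ * _); rewrite -[2 in X in _ `^ X]/(2%:R) powR_mulrn ?mulr_ge0 ?(ltW r0)//.
  by ring.
have E1 : (2^-1 `^ beta * cabs (F 0)) `^ p <= Q.
  apply: (@le_trans _ _ ((2 * ((2 * r) `^ beta * m)) `^ p)).
    apply: ge0_ler_powR => //; first exact: ltW.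
    - by rewrite nnegrE mulr_ge0 ?cabs_ge0// ltW.
    - by rewrite nnegrE !mulr_ge0 ?powR_ge0.
  have -> : Q = 2 `^ p * (2 `^ p * (M * pi / (c * k ^+ 2))) by exact/esym/mulrA.
  rewrite powRM ?mulr_ge0 ?powR_ge0// mE ler_wpM2l ?powR_ge0//.
  rewrite -[m in m `^ p](divfK (lt0r_neq0 (ltr0n R 2))) powRM ?divr_ge0//.
  rewrite [(m / 2) `^ p * _]mulrC -[leLHS]mulrA ler_wpM2l ?powR_ge0//.
  rewrite ler_pdivlMr ?mulr_gt0 ?exprn_gt0//.
  rewrite (le_trans _ HL)// /d (exprMn 2 r k) le_eqVlt; apply/orP; left; apply/eqP.
  have I (x c' r' k' : R) : x * (4 * r') * (c' * k') = c' * x * (4 * (r' * k')) by ring.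
  exact: I.
have X0 : 0 <= 2^-1 `^ beta * cabs (F 0) by rewrite mulr_ge0 ?cabs_ge0// ltW.
rewrite ler_pdivlMr// mulrC.
set X := _ * _ in X0 E1 *.
have -> : X = (X `^ p) `^ p^-1 by rewrite -powRrM divff ?gt_eqF// powRr1.
apply: ge0_ler_powR => //.
- by rewrite invr_ge0 ltW.
- by rewrite nnegrE powR_ge0.
- by rewrite nnegrE (le_trans _ E1) ?powR_ge0.
Qed.

End AreaLowerBound.

(** * A singular weight that is integrable *)

Section SingularIntegral.
Context {R : realType}.
Local Notation C := R[i].
Local Notation leb := (@lebesgue_measure R).
Local Notation leb2 := ((@lebesgue_measure R) \x (@lebesgue_measure R))%E.

(** The integrand may be unbounded at both ends: exhaust the interval by compact
   ones and pass to the monotone limit. *)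
Lemma integral_oo_le (f F : R -> R) (a b B : R) : a < b ->
  (forall x, a < x < b -> 0 <= f x) ->
  (forall x : R, a < x < b -> derivable F x 1 /\ F^`() x = f x) ->
  (forall x, a < x < b -> {for x, continuous f}) ->
  (forall x y, a < x < b -> a < y < b -> F y - F x <= B) ->
  (\int[leb]_(x in `]a, b[) (f x)%:E <= B%:E)%E.
Proof.
move=> ab f0 dF cf FB.
(* With a denominator of at least 3 every interval is nondegenerate. *)
pose e (i : nat) : R := (b - a) / i.+3%:R.
pose I i : set R := `[a + e i, b - e i].
have ba : 0 < b - a by rewrite subr_gt0.
have e0 i : 0 < e i by rewrite divr_gt0.
have e3 i : e i <= (b - a) / 3.
  by rewrite ler_pM2l// lef_pV2 ?posrE// ler_nat.
have ei i : a + e i < b - e i by have := e3 i; move: ba; lra.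
have Iab i x : I i x -> a < x < b.
  rewrite /I/= in_itv/= => /andP[ax xb].
  rewrite (lt_le_trans _ ax) ?ltrDl// (le_lt_trans xb)//.
  by rewrite ltrBlDr ltrDl.
have UI : \bigcup_i I i = `]a, b[.
  apply/seteqP; split=> x /=.
    by move=> [i _ /Iab]; rewrite in_itv.
  rewrite in_itv/= => /andP[ax xb].
  pose d := Num.min (x - a) (b - x).
  have d0 : 0 < d by rewrite lt_min !subr_gt0 ax xb.
  pose k := Num.truncn ((b - a) / d).
  have ek : e k <= d.
    rewrite /e ler_pdivrMr// mulrC -ler_pdivrMr//.
    have /ltW/le_trans := truncnS_gt ((b - a) / d); apply.
    by rewrite ler_nat /k !ltnS ltnW// ltnW.
  exists k => //; rewrite /I/= in_itv/=; move: ek; rewrite le_min => /andP[h1 h2].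
  by rewrite -lerBrDl h1 lerBrDr -lerBrDl.
have cont x : a < x < b -> {for x, continuous F}.
  by move=> xab; apply: differentiable_continuous; apply/derivable1_diffP; exact: (dF x xab).1.
have cIf i : {within I i, continuous f}.
  apply: (@continuous_in_subspaceT _ _ (I i) f) => x; rewrite inE => /Iab; exact: cf.
have Ii i : (\int[leb]_(x in I i) (f x)%:E <= B%:E)%E.
  rewrite (@continuous_FTC2 _ f F (a + e i) (b - e i))//.
  - rewrite -EFinB lee_fin; apply: FB; apply: (@Iab i); rewrite /I/= in_itv/= lexx ltW//.
  - exact: cIf.
  - split.
    + move=> x; rewrite in_itv/= => /andP[h1 h2].
      apply: (dF x _).1; apply: (@Iab i).
      by rewrite /I/= in_itv/= !ltW.
    + apply: cvg_at_right_filter; apply: cont; apply: (@Iab i).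
      by rewrite /I/= in_itv/= lexx ltW.
    + apply: cvg_at_left_filter; apply: cont; apply: (@Iab i).
      by rewrite /I/= in_itv/= lexx ltW.
  - move=> x; rewrite in_itv/= => /andP[h1 h2].
    apply: (dF x _).2; apply: (@Iab i).
    by rewrite /I/= in_itv/= !ltW.
have mono : nondecreasing_seq I.
  move=> m n mn; apply/subsetPset => x; rewrite /I/= !in_itv/=.
  have eE : e n <= e m by rewrite ler_pM2l// lef_pV2 ?posrE// ler_nat !ltnS.
  by move=> /andP[h1 h2]; rewrite (le_trans _ h1) ?lerD2l// (le_trans h2)// lerD2l lerN2.
have mf i : measurable_fun (I i) (EFin \o f).
  apply/measurable_EFinP; apply: subspace_continuous_measurable_fun => //.
  exact: measurable_itv.
have f0' i x : I i x -> (0 <= (f x)%:E)%E by move=> /Iab /f0; rewrite lee_fin.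
have cvgI : (\int[leb]_(x in I i) (EFin \o f) x)%E @[i --> \oo] -->
    (\int[leb]_(x in \bigcup_i I i) (EFin \o f) x)%E.
  apply: ge0_nondecreasing_set_cvg_integral => //.
  by move=> i; exact: measurable_itv.
move: cvgI; rewrite UI => cvgI; rewrite -(cvg_lim _ cvgI)//.
apply: lime_le; first by apply/cvg_ex; eexists; exact: cvgI.
by apply: nearW.
Qed.

Definition endpoint_weight (r s y : R) : R := (r - y) `^ s + (y + r) `^ s.

Lemma endpoint_weight_ge0 r s y : 0 <= endpoint_weight r s y.
Proof. by rewrite addr_ge0 ?powR_ge0. Qed.

Lemma is_derive_powR_addr (r s y : R) : 0 < y + r ->
  is_derive y 1 (fun y => (y + r) `^ s) (s * (y + r) `^ (s - 1)).
Proof.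
move=> yr; have D := is_derive1_powR s yr.
have E : is_derive y 1 (shift r) 1 := is_derive_shift y 1 r.
by have := @is_derive1_comp R (fun x => x `^ s) (shift r) y _ _ D E; rewrite mulr1.
Qed.

Lemma is_derive_powR_subl (r s y : R) : 0 < r - y ->
  is_derive y 1 (fun y => (r - y) `^ s) (- (s * (r - y) `^ (s - 1))).
Proof.
move=> yr; have D := is_derive1_powR s yr.
have E : is_derive y 1 (cst r - id) (0 - 1) :=
  is_deriveB (is_derive_cst r y 1) (is_derive_id y 1).
have := @is_derive1_comp R (fun x => x `^ s) (cst r - id) y _ _ D E.
by rewrite sub0r mulrN1.
Qed.

Lemma is_derive_continuous (f : R -> R) (x l : R) :
  is_derive x 1 f l -> {for x, continuous f}.
Proof.
by move=> [df _]; apply: differentiable_continuous; exact/derivable1_diffP.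
Qed.

Lemma integral_endpoint_weight (r s c : R) : 0 < r -> -1 < s -> 0 <= c ->
  (\int[leb]_(y in `](- r)%R, r[) (c * endpoint_weight r s y)%R%:E <=
   (c * (2 * (2 * r) `^ (s + 1) / (s + 1)))%R%:E)%E.
Proof.
move=> r0 s1 c0.
have s0 : 0 < s + 1 by rewrite -ltrBlDr sub0r.
pose k := c / (s + 1).
have k0 : 0 <= k by rewrite divr_ge0// ltW.
have pos (y : R) : - r < y < r -> 0 < r - y /\ 0 < y + r.
  by move=> /andP[h1 h2]; rewrite subr_gt0 h2 -ltrBlDr sub0r h1.
pose F y := k * ((y + r) `^ (s + 1) - (r - y) `^ (s + 1)).
apply: (@integral_oo_le _ F).
- by rewrite gtrN.
- by move=> y _; rewrite mulr_ge0// endpoint_weight_ge0.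
- move=> y /pos[h1 h2].
  have D1 := is_derive_powR_addr (s + 1) h2.
  have D2 := is_derive_powR_subl (s + 1) h1.
  have D := is_deriveZ k (is_deriveB D1 D2).
  have E : k *: ((s + 1) * (y + r) `^ (s + 1 - 1) - - ((s + 1) * (r - y) `^ (s + 1 - 1)))
     = c * endpoint_weight r s y.
    rewrite /k /endpoint_weight /GRing.scale/= addrK.
    by field; rewrite gt_eqF.
  have DF : is_derive y 1 F (c * endpoint_weight r s y) by rewrite -E; exact: D.
  case: DF => dF vF; by split; [exact: dF|rewrite derive1E; exact: vF].
- move=> y /pos[h1 h2].
  have C1 := is_derive_continuous (is_derive_powR_addr s h2).
  have C2 := is_derive_continuous (is_derive_powR_subl s h1).
  by apply: cvgM; [exact: cvg_cst|apply: cvgD; [exact: C2|exact: C1]].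
move=> x y /pos[h1 h2] /pos[h3 h4].
have A (t : R) : 0 < t -> t <= 2 * r -> 0 <= t `^ (s + 1) <= (2 * r) `^ (s + 1).
  move=> t0 tr; rewrite powR_ge0/=; apply: ge0_ler_powR => //; first exact: ltW.
  - by rewrite nnegrE ltW.
  - by rewrite nnegrE mulr_ge0// ltW.
have /andP[a1 a2] : 0 <= (y + r) `^ (s + 1) <= (2 * r) `^ (s + 1).
  by apply: A h4 _; rewrite mulr_natl mulr2n lerD2r -subr_ge0 ltW.
have /andP[b1 b2] : 0 <= (r - x) `^ (s + 1) <= (2 * r) `^ (s + 1).
  by apply: A h1 _; rewrite mulr_natl mulr2n lerD2l -subr_ge0 opprK addrC ltW.
have e1 := powR_ge0 (r - y) (s + 1); have e2 := powR_ge0 (x + r) (s + 1).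
rewrite /F -mulrBr (_ : c * _ = k * (2 * (2 * r) `^ (s + 1))); last first.
  by rewrite /k; field; rewrite gt_eqF.
apply: ler_wpM2l => //.
move: a1 a2 b1 b2 e1 e2.
move: ((y + r) `^ _) ((r - x) `^ _) ((r - y) `^ _) ((x + r) `^ _) ((2 * r) `^ _).
clear; move=> u v w t q; lra.
Qed.

Lemma ler0_powR (a b s : R) : 0 < a -> a <= b -> s <= 0 -> b `^ s <= a `^ s.
Proof.
move=> a0 ab s0; rewrite -[s]opprK (powRN b (- s)) (powRN a (- s)).
have b0 : 0 < b by apply: lt_le_trans ab.
rewrite lef_pV2 ?posrE ?powR_gt0//; apply: ge0_ler_powR => //.
- by rewrite oppr_ge0.
- by rewrite nnegrE ltW.
- by rewrite nnegrE ltW.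
Qed.

Lemma disk_weight_le (r s x y : R) : 0 < r -> s <= 0 -> r ^+ 2 = 1 - x ^+ 2 ->
  x ^+ 2 + y ^+ 2 < 1 -> - r < y < r /\
  (1 - (x ^+ 2 + y ^+ 2)) `^ s <= r `^ s * endpoint_weight r s y.
Proof.
move=> r0 s0 rx xy.
have yr : `|y| < r.
  rewrite -(@ltr_pXn2r _ 2)// ?nnegrE ?normr_ge0// ?(ltW r0)//.
  by rewrite real_normK ?num_real// rx; lra.
split; first by rewrite -ltr_norml.
have d0 : 0 < r - `|y| by rewrite subr_gt0.
have E : 1 - (x ^+ 2 + y ^+ 2) = (r - `|y|) * (r + `|y|).
  by rewrite -subr_sqr real_normK ?num_real// rx; ring.
apply: (@le_trans _ _ ((r * (r - `|y|)) `^ s)).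
  apply: ler0_powR => //; first by rewrite mulr_gt0.
  by rewrite E mulrC ler_wpM2l ?(ltW d0)// lerDl.
rewrite powRM ?(ltW r0) ?(ltW d0)// ler_wpM2l ?powR_ge0// /endpoint_weight.
case: (ger0P y) => y0; first by rewrite lerDl powR_ge0.
by rewrite opprK [r + y]addrC lerDr powR_ge0.
Qed.

Definition plane_sqr (xy : R * R) : R := xy.1 ^+ 2 + xy.2 ^+ 2.

Lemma cabs_of_plane (xy : R * R) : cabs (of_plane xy) ^+ 2 = plane_sqr xy.
Proof. by rewrite cabs_sqr. Qed.

Lemma measurable_plane_sqr : measurable_fun setT plane_sqr.
Proof.
apply: measurable_funD; apply: measurable_funX.
  exact: measurable_fst.
exact: measurable_snd.
Qed.

Lemma plane_diskE : plane_disk (R := R) = plane_sqr @^-1` `]-oo, 1[.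
Proof.
apply/seteqP; split=> xy; rewrite /plane_disk/= disk_sqr cabs_of_plane /=.
  by rewrite in_itv.
by rewrite in_itv.
Qed.

Lemma measurable_plane_disk : measurable (plane_disk (R := R)).
Proof.
rewrite plane_diskE -[X in measurable X]setTI.
by apply: measurable_plane_sqr => //; exact: measurable_itv.
Qed.

(** Fubini over the chords [|y| < r], [r^2 = 1 - x^2], on which
   [1 - x^2 - y^2 >= r (r - |y|)]. *)
Lemma disk_weight_integral (s : R) : -1 < s -> s <= 0 ->
  exists B : R, (\int[leb2]_(xy in plane_disk (R := R))
     ((1 - plane_sqr xy) `^ s)%R%:E <= B%:E)%E.
Proof.
move=> s1 s0.
have sp : 0 < s + 1 by rewrite -ltrBlDr sub0r.
pose K := 2 * 2 `^ (s + 1) / (s + 1).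
have K0 : 0 <= K by rewrite divr_ge0 ?(ltW sp)// mulr_ge0 ?powR_ge0.
exists (K * (2 * (2 * 1) `^ (s + 1) / (s + 1))).
pose f (xy : R * R) : \bar R := ((1 - plane_sqr xy) `^ s)%R%:E.
have mf : measurable_fun setT f.
  apply/measurable_EFinP.
  apply: (@measurableT_comp _ _ _ _ _ _ (fun t : R => t `^ s)); first exact: measurable_powR.
  by apply: measurable_funB => //; exact: measurable_plane_sqr.
rewrite integral_mkcond; set g := patch _ _ _.
have g0 xy : (0 <= g xy)%E.
  by rewrite /g patchE; case: ifPn => // _; rewrite lee_fin powR_ge0.
have mg : measurable_fun setT g.
  apply/(measurable_restrictT f measurable_plane_disk).
  exact: measurable_funTS.
rewrite (fubini_tonelli1 g mg g0).
apply: (@le_trans _ _ (\int[leb]_(y in `](- 1)%R, 1%R[) (K * endpoint_weight 1 s y)%R%:E)%E); last first.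
  exact: (integral_endpoint_weight ltr01 s1 K0).
rewrite [leRHS]integral_mkcond; apply: ge0_le_integral_any => x _.
  by apply: integral_ge0 => y _; exact: g0.
rewrite /fubini_F patchE; case: ifPn => [|xI]; last first.
  rewrite integral0_eq// => y _; rewrite /g patchE ifF//.
  apply/negbTE; apply: contra xI; rewrite !inE /= plane_diskE/= !in_itv/= /plane_sqr/= => xy.
  rewrite -ltr_norml -(@ltr_pXn2r _ 2)// ?nnegrE// real_normK ?num_real// expr1n.
  by rewrite (le_lt_trans _ xy)// lerDl sqr_ge0.
rewrite inE/= in_itv/= => x1.
have x2 : x ^+ 2 < 1.
  by rewrite -real_normK ?num_real// expr_lt1// ltr_norml.
pose r := Num.sqrt (1 - x ^+ 2).
have r0 : 0 < r by rewrite sqrtr_gt0 subr_gt0.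
have rx : r ^+ 2 = 1 - x ^+ 2 by rewrite sqr_sqrtr// subr_ge0 ltW.
have r1 : r <= 1.
  by rewrite -(@ler_pXn2r _ 2)// ?nnegrE ?(ltW r0)// expr1n rx gerBl sqr_ge0.
have rs0 : 0 <= r `^ s by exact: powR_ge0.
apply: (@le_trans _ _ (r `^ s * (2 * (2 * r) `^ (s + 1) / (s + 1)))%R%:E).
  apply: (le_trans _ (integral_endpoint_weight r0 s1 rs0)).
  rewrite [leRHS]integral_mkcond; apply: ge0_le_integral_any => y _; first exact: g0.
  rewrite /g !patchE; case: ifPn => [|_]; last first.
    by case: ifPn => // _; rewrite lee_fin mulr_ge0// endpoint_weight_ge0.
  rewrite inE/= plane_diskE/= in_itv/= /plane_sqr/= => xy.
  have [yr W] := disk_weight_le r0 s0 rx xy.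
  by rewrite ifT ?lee_fin// inE/= in_itv.
rewrite lee_fin powRM ?(ltW r0)//.
have -> : r `^ s * (2 * (2 `^ (s + 1) * r `^ (s + 1)) / (s + 1)) = K * (r `^ s * r `^ (s + 1)).
  by rewrite /K; ring.
apply: ler_wpM2l => //.
have xx : 0 ^+ 2 + x ^+ 2 < 1 :> R by rewrite expr0n/= add0r.
have r11 : 1 ^+ 2 = 1 - 0 ^+ 2 :> R by rewrite expr1n expr0n subr0.
have [_] := disk_weight_le ltr01 s0 r11 xx.
rewrite powR1 mul1r expr0n/= add0r; apply: le_trans.
rewrite -rx -powR_mulrn ?(ltW r0)// -powRrM mulr_natl mulr2n.
have rn : r != 0 by rewrite gt_eqF.
rewrite -powRD ?rn ?implybT//.
by apply: ger_powR; [rewrite r0 r1|rewrite addrA lerDl].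
Qed.

End SingularIntegral.

(** * Bloch functions have bounded weighted means of all derivatives *)

Section BlochGrowth.
Context {R : realType}.
Local Notation C := R[i].
Local Notation rc := (real_complex R).
Local Notation leb2 := ((@lebesgue_measure R) \x (@lebesgue_measure R))%E.
Implicit Types (z w : C).

(** Cauchy's estimate on the disc about [z] of radius [(1 - |z|) / 4]; on it
   [1 - |w|] is at least half of [1 - |z|]. *)
Lemma derive_growth m (q : C -> C^o) B : hol (disk (R := R)) q ->
  (forall z, disk z -> (1 - cabs z) ^+ m * cabs (q z) <= B) ->
  forall z, disk z -> (1 - cabs z) ^+ m.+1 * cabs (q^`() z) <= 4 * 2 ^+ m * B.
Proof.
move=> hq qB z zD; pose d := 1 - cabs z.
have d0 : 0 < d by rewrite subr_gt0.
have d2 : 0 < d / 2 by rewrite divr_gt0.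
have sub w (s : R) : s <= d / 2 -> cball z s w -> d / 2 <= 1 - cabs w.
  move=> sd; rewrite /cball/= => wz.
  have := cabsD (w - z) z; rewrite subrK => H.
  rewrite lerBrDr -lerBrDl (le_trans H)//.
  have -> : 1 - d / 2 = d / 2 + cabs z by rewrite /d; field.
  by rewrite lerD2r (le_trans wz).
have zU : cball z (d / 2) `<=` disk (R := R).
  move=> w /(sub w _ (lexx _)) H; rewrite /disk/= -subr_gt0.
  exact: lt_le_trans H.
have d42 : d / 4 < d / 2 by rewrite ltr_pM2l// ltf_pV2 ?posrE// ltr_nat.
have qw w : cball z (d / 4) w -> cabs (q w) <= B / (d / 2) ^+ m.
  move=> wz; have H := sub w _ (ltW d42) wz.
  have wD : disk w by rewrite /disk/= -subr_gt0; exact: lt_le_trans H.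
  rewrite ler_pdivlMr ?exprn_gt0// mulrC (le_trans _ (qB w wD))//.
  by rewrite ler_wpM2r ?cabs_ge0// lerXn2r// nnegrE ltW// (lt_le_trans d2).
have d4 : 0 < d / 4 by rewrite divr_gt0.
have := cauchy_estimate hq d4 d42 zU qw.
have dm : 0 <= d ^+ m.+1 by rewrite exprn_ge0// ltW.
move=> /(ler_wpM2l dm) /le_trans; apply.
rewrite le_eqVlt; apply/orP; left; apply/eqP; rewrite exprS expr_div_n.
have dn : d ^+ m != 0 by rewrite expf_neq0// gt_eqF.
have tn : 2 ^+ m != 0 :> R by rewrite expf_neq0.
have dz : d != 0 by rewrite gt_eqF.
by field; rewrite ?dn ?dz ?tn.
Qed.

Lemma derivn_growth n : exists c : R, forall (q : C -> C^o) B,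
  hol (disk (R := R)) q ->
  (forall z, disk z -> (1 - cabs z) * cabs (q^`() z) <= B) ->
  forall z, disk z -> (1 - cabs z) ^+ n.+1 * cabs (q^`(n.+1) z) <= c * B.
Proof.
elim: n => [|n [c IH]].
  by exists 1 => q B hq H z zD; rewrite expr1 mul1r; exact: H.
exists (4 * 2 ^+ n.+1 * c) => q B hq H z zD.
rewrite derive1nS -[leRHS]mulrA.
apply: (derive_growth (hol_derivn n.+1 copen_disk hq)) => // w wD.
exact: (IH q B hq H w wD).
Qed.

Lemma measurable_disk_weight (s : R) :
  measurable_fun (plane_disk (R := R)) (EFin \o (fun xy => (1 - plane_sqr xy) `^ s)).
Proof.
apply: measurable_funTS; apply/measurable_EFinP.
apply: (@measurableT_comp _ _ _ _ _ _ (fun t : R => t `^ s)); first exact: measurable_powR.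
by apply: measurable_funB => //; exact: measurable_plane_sqr.
Qed.

Lemma weight_bound (N : nat) (p alpha s A t psi : R) : 0 < p -> 0 <= A ->
  0 < t -> t <= 1 -> 0 <= psi -> (t / 2) ^+ N * psi <= A ->
  s <= alpha - N%:R * p ->
  psi `^ p * t `^ alpha <= (A * 2 ^+ N) `^ p * t `^ s.
Proof.
move=> p0 A0 t0 t1 psi0 H sa.
have tn : t != 0 by rewrite gt_eqF.
have tN : 0 < t ^+ N by rewrite exprn_gt0.
have psile : psi <= A * 2 ^+ N * t `^ (- N%:R).
  rewrite powR_invn ?(ltW t0)// ler_pdivlMr//.
  rewrite -ler_pdivrMr ?exprn_gt0// (le_trans _ H)// expr_div_n le_eqVlt.
  by apply/orP; left; apply/eqP; rewrite -mulrA mulrC.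
apply: (@le_trans _ _ ((A * 2 ^+ N * t `^ (- N%:R)) `^ p * t `^ alpha)).
  rewrite ler_wpM2r ?powR_ge0//; apply: ge0_ler_powR => //; first exact: ltW.
  by rewrite nnegrE !mulr_ge0 ?powR_ge0 ?exprn_ge0.
rewrite powRM ?powR_ge0 ?mulr_ge0 ?exprn_ge0// -mulrA ler_wpM2l ?powR_ge0//.
rewrite -powRrM -powRD ?tn ?implybT//; apply: ger_powR; first by rewrite t0 t1.
by rewrite mulNr addrC.
Qed.

(** The integrand is at most a multiple of [(1 - |z|^2)^(alpha - N p)], which the
   condition [N p - 1 < alpha] makes integrable.  Cutting the exponent at zero
   leaves only the singular case. *)
Lemma area_integral_growth (N : nat) (p alpha A : R) : 0 < p ->
  N%:R * p - 1 < alpha -> 0 <= A -> exists M : R, forall psi : C -> R,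
  (forall z, disk z -> 0 <= psi z) ->
  (forall z, disk z -> (1 - cabs z) ^+ N * psi z <= A) ->
  (area_integral (fun z => (psi z `^ p * (1 - cabs z ^+ 2) `^ alpha)%R) <= M%:E)%E.
Proof.
move=> p0 palpha A0; pose s := Num.min (alpha - N%:R * p) 0.
have s1 : -1 < s.
  by rewrite lt_min ltrBrDr addrC palpha oppr_lt0 ltr01.
have s0 : s <= 0 by rewrite ge_min lexx orbT.
have [B HB] := disk_weight_integral s1 s0.
pose k := (A * 2 ^+ N) `^ p.
have k0 : 0 <= k by exact: powR_ge0.
exists (pi^-1 * (k * B)) => psi psi0 psiA.
have pi0 : 0 < pi :> R := pi_gt0 R.
rewrite /area_integral EFinM lee_pmul2l// ?lte_fin ?invr_gt0//.
apply: (@le_trans _ _ (\int[leb2]_(xy in plane_disk (R := R))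
   (k%:E * ((1 - plane_sqr xy) `^ s)%R%:E))%E).
  apply: ge0_le_integral_any => xy xyD; rewrite -?EFinM lee_fin.
    by rewrite mulr_ge0 ?powR_ge0.
  have zD : disk (of_plane xy) := xyD.
  rewrite -cabs_of_plane; set z := of_plane xy in zD *.
  have t0 : 0 < 1 - cabs z ^+ 2 by move: zD; rewrite disk_sqr subr_gt0.
  apply: weight_bound => //.
  - by rewrite gerBl sqr_ge0.
  - exact: psi0.
  - rewrite (le_trans _ (psiA z zD))// ler_wpM2r ?psi0//.
    have c0 := cabs_ge0 z; have c1 : cabs z < 1 by [].
    rewrite lerXn2r ?nnegrE ?divr_ge0 ?(ltW t0) ?subr_ge0 ?(ltW c1)//.
    have -> : 1 - cabs z ^+ 2 = (1 - cabs z) * (1 + cabs z) by ring.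
    rewrite ler_pdivrMr// ler_wpM2l ?subr_ge0 ?(ltW c1)//.
    by rewrite -[leRHS]/(1 + 1) lerD2l ltW.
  - by rewrite ge_min lexx.
rewrite ge0_integralZl_EFin//.
- by rewrite EFinM lee_wpmul2l ?lee_fin.
- exact: measurable_plane_disk.
- by move=> xy _; rewrite lee_fin powR_ge0.
- exact: (measurable_disk_weight s).
Qed.

End BlochGrowth.

(** * Partial derivatives in the plane *)

Section Plane.
Context {R : realType}.
Local Notation C := R[i].
Local Notation rc := (real_complex R).
Implicit Types (z : C) (u : R * R -> R) (xy v : R * R).

Lemma hderiv_conj (P : R -> C) t l : rderiv P t l ->
  rderiv (fun x => conjc (P x)) t (conjc l).
Proof.
move=> dP e /dP[d d0 H]; exists d => // h /H; apply: le_trans.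
rewrite -(cabs_conj (P (t + h) - P t - rc h * l)).
have -> // : forall a b c : C, conjc a - conjc b - rc h * conjc c = conjc (a - b - rc h * c).
move=> [a1 a2] [b1 b2] [c1 c2]; apply/eqP; rewrite eq_complex/=.
by apply/andP; split; apply/eqP; ring.
Qed.

Lemma of_plane_x xy (t : R) : of_plane (xy + t *: e_x R) = of_plane xy + rc t * 1.
Proof.
case: xy => x y; apply/eqP; rewrite eq_complex/= /GRing.scale/=.
by apply/andP; split; apply/eqP; ring.
Qed.

Lemma of_plane_y xy (t : R) : of_plane (xy + t *: e_y R) = of_plane xy + rc t * 'i%C.
Proof.
case: xy => x y; apply/eqP; rewrite eq_complex/= /GRing.scale/=.
by apply/andP; split; apply/eqP; ring.
Qed.

Lemma rderiv_line u xy v l : rderiv (fun t => rc (u (xy + t *: v))) 0 l ->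
  [/\ derivable u xy v, 'D_v u xy = complex.Re l & complex.Im l = 0].
Proof.
move=> dP; pose P t := rc (u (xy + t *: v)).
have d1 : is_derive (0 : R) 1 (fun t => complex.Re (P t)) (complex.Re l) := rderiv_Re dP.
have d2 : is_derive (0 : R) 1 (fun t => complex.Re (- 'i%C * P t)) (complex.Re (- 'i%C * l)).
  by apply: rderiv_Re; exact: hderivZ.
have E : (fun h => h^-1 *: (((fun t => complex.Re (P t)) \o shift (0 : R)) (h *: 1) - complex.Re (P 0)))
   = (fun h => h^-1 *: ((u \o shift xy) (h *: v) - u xy)).
  apply/funext => h /=; rewrite addr0 scale0r addr0 [h *: 1]mulr1.
  by rewrite [h *: v + xy]addrC.
split.
- by case: d1 => + _; rewrite /derivable E.
- by case: d1 => _; rewrite /derive E.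
have -> : complex.Im l = complex.Re (- 'i%C * l) by case: (l) => a b /=; ring.
case: d2 => _ <-.
rewrite (_ : (fun t => _) = cst 0) ?derive_cst//.
by apply/funext => t; rewrite /P /=; ring.
Qed.

Lemma plane_disk_line v xy (w : C) : (forall t : R, of_plane (xy + t *: v) = of_plane xy + rc t * w) ->
  cabs w = 1 -> plane_disk xy -> exists2 r, 0 < r & forall t : R, `|t| <= r -> plane_disk (xy + t *: v).
Proof.
move=> vE w1 /copen_disk[r r0 /cballP H]; exists r => // t tr.
by rewrite /plane_disk/= vE; apply: H; rewrite cabsM w1 mulr1 cabs_rc.
Qed.

Lemma cabs_i : cabs ('i%C : C) = 1.
Proof. by rewrite cabs_sqrt/= expr0n expr1n add0r sqrtr1. Qed.

Lemma wirtinger_sum (i a c : C) : i ^+ 2 = -1 ->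
  a = (a + c - i * (i * a + - (i * c))) / 2.
Proof.
move=> i2; have -> : a + c - i * (i * a + - (i * c)) = a + c - i ^+ 2 * (a - c) by ring.
by rewrite i2; field.
Qed.

(** Moving along [w = 1] and [w = i] turns [a + conj b] into a curve whose velocity
   is [w a' + conj (w b')]. *)
Lemma partials_of_decomposition u (a b : C -> C) a' b' xy : plane_disk xy ->
  (forall xy, plane_disk xy -> rc (u xy) = a (of_plane xy) + conjc (b (of_plane xy))) ->
  cderiv a (of_plane xy) a' -> cderiv b (of_plane xy) b' ->
  [/\ derivable u xy (e_x R), derivable u xy (e_y R),
      rc ('D_(e_x R) u xy) = a' + conjc b' &
      rc ('D_(e_y R) u xy) = 'i%C * a' + conjc ('i%C * b')].
Proof.
move=> xyD uE da db.
have dir v w : (forall t : R, of_plane (xy + t *: v) = of_plane xy + rc t * w) -> cabs w = 1 ->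
    derivable u xy v /\ rc ('D_v u xy) = w * a' + conjc (w * b').
  move=> vE w1; have [r r0 Hr] := plane_disk_line vE w1 xyD.
  have z0 : of_plane xy + rc 0 * w = of_plane xy by rewrite rmorph0 mul0r addr0.
  have dl : rderiv (fun t => rc (u (xy + t *: v))) 0 (w * a' + conjc (w * b')).
    have da' : cderiv a (of_plane xy + rc 0 * w) a' by rewrite z0.
    have db' : cderiv b (of_plane xy + rc 0 * w) b' by rewrite z0.
    have D := hderivD (cderiv_rderiv da') (hderiv_conj (cderiv_rderiv db')).
    apply: (hderiv_near r0 _ D) => h; rewrite cabs_rc add0r => hr.
    by rewrite uE ?vE//; exact: Hr.
  have [d1 d2 d3] := rderiv_line dl; split => //.
  by rewrite d2 [RHS]complexE d3 mulr0 addr0.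
have [dx Ex] := dir _ _ (of_plane_x xy) (@cabs1 R).
have [dy Ey] := dir _ _ (of_plane_y xy) cabs_i.
by split => //; rewrite Ex !mul1r.
Qed.

Lemma wirtinger u (a b : C -> C) a' b' xy : plane_disk xy ->
  (forall xy, plane_disk xy -> rc (u xy) = a (of_plane xy) + conjc (b (of_plane xy))) ->
  cderiv a (of_plane xy) a' -> cderiv b (of_plane xy) b' ->
  a' = (rc ('D_(e_x R) u xy) - 'i%C * rc ('D_(e_y R) u xy)) / 2.
Proof.
move=> xyD uE da db; have [_ _ -> ->] := partials_of_decomposition xyD uE da db.
have -> : conjc ('i%C * b') = - ('i%C * conjc b').
  by case: (b') => x y; apply/eqP; rewrite eq_complex/=; apply/andP; split; apply/eqP; ring.
exact: (wirtinger_sum _ _ (sqr_i R)).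
Qed.

Lemma plane_continuousP (g : R * R -> R) xy : {for xy, continuous g} ->
  ccont (fun z => rc (g (complex.Re z, complex.Im z))) (of_plane xy).
Proof.
case: xy => x y /cvgrPdist_le cg e e0.
have [[/= A B] [[r1 /= r10 A1] [r2 /= r20 B1]] AB] := cg e e0.
pose d := Num.min r1 r2 / 2.
have m0 : 0 < Num.min r1 r2 by rewrite lt_min r10.
have dm : d < Num.min r1 r2 by rewrite ltr_pdivrMr// ltr_pMr// ltr1n.
exists d; first by rewrite divr_gt0.
move=> h /= hd; rewrite -rmorphB cabs_rc distrC; rewrite ReD ImD /=.
apply: (AB (x + complex.Re h, y + complex.Im h)); split.
  apply: A1; rewrite /ball_/= opprD addrA subrr add0r normrN.
  rewrite (le_lt_trans (cabs_Re _))// (le_lt_trans hd)// (lt_le_trans dm)//.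
  by rewrite ge_min lexx.
apply: B1; rewrite /ball_/= opprD addrA subrr add0r normrN.
rewrite (le_lt_trans (cabs_Im _))// (le_lt_trans hd)// (lt_le_trans dm)//.
by rewrite ge_min lexx orbT.
Qed.

Lemma ccont_plane (F : C -> C) xy : ccont F (of_plane xy) ->
  {for xy, continuous (fun xy => complex.Re (F (of_plane xy)))}.
Proof.
case: xy => x y cF; apply/cvgrPdist_le => e /cF[d d0 H].
have d2 : 0 < d / 2 by rewrite divr_gt0.
exists (ball x (d / 2), ball y (d / 2)); first by split; exact: nbhsx_ballx.
move=> [x' y'] [/= xd yd].
pose h := of_plane (x' - x, y' - y).
have hd : cabs h <= d.
  rewrite (le_trans (cabs_le_ReIm _))//= [d]splitr lerD// distrC; exact: ltW.
have -> : of_plane (x', y') = of_plane (x, y) + h.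
  by apply/eqP; rewrite eq_complex/= [x + _]addrC [y + _]addrC !subrK !eqxx.
rewrite distrC -ReN -ReD (le_trans (cabs_Re _))//; exact: H.
Qed.

(** The derivative of [a] is a Wirtinger derivative of [u], which is continuous. *)
Lemma hol_of_C1_decomposition u (a b : C -> C^o) : C1_disk u ->
  (forall xy, plane_disk xy -> rc (u xy) = a (of_plane xy) + conjc (b (of_plane xy))) ->
  analytic a -> analytic b -> hol (disk (R := R)) a.
Proof.
move=> C1u uE aa ab.
have W xy : plane_disk xy -> a^`() (of_plane xy) =
    (rc ('D_(e_x R) u xy) - 'i%C * rc ('D_(e_y R) u xy)) / 2.
  move=> xyD; apply: (wirtinger xyD uE (derivable_cderiv (aa _ xyD)) (derivable_cderiv (ab _ xyD))).
split=> z zD; first exact: derivable_cderiv (aa z zD).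
have xyD : plane_disk (complex.Re z, complex.Im z) by rewrite /plane_disk/= of_planeK.
have [_ _ _ cx cy] := C1u _ xyD.
have cW : ccont (fun z => (rc ('D_(e_x R) u (complex.Re z, complex.Im z)) -
    'i%C * rc ('D_(e_y R) u (complex.Re z, complex.Im z))) / 2) z.
  have cx' := plane_continuousP cx; have cy' := plane_continuousP cy.
  rewrite of_planeK in cx' cy'.
  by apply: hcontM (hcont_cst _ _ _); apply: hcontB cx' _; apply: hcontM (hcont_cst _ _ _) cy'.
have [r r0 /cballP zr] := copen_disk zD.
apply: (hcont_near r0 _ cW) => h hr.
have hD : plane_disk (complex.Re (z + h), complex.Im (z + h)).
  by rewrite /plane_disk/= of_planeK; exact: zr.
by have := W _ hD; rewrite of_planeK => ->.
Qed.

Lemma half_conj z : rc 2^-1 * z + conjc (rc 2^-1 * z) = rc (complex.Re z).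
Proof.
case: z => x y; apply/eqP; rewrite eq_complex/=.
by apply/andP; split; apply/eqP; field.
Qed.

Lemma hol_real_part (F : C -> C^o) u : hol (disk (R := R)) F ->
  (forall xy, plane_disk xy -> u xy = complex.Re (F (of_plane xy))) ->
  [/\ C1_disk u,
      forall xy, plane_disk xy -> 'D_(e_x R) u xy = complex.Re (F^`() (of_plane xy)) &
      forall xy, plane_disk xy -> 'D_(e_y R) u xy = complex.Re ('i%C * derive1 F (of_plane xy))].
Proof.
move=> hF uE; have [dF cF] := hF.
have uE' xy : plane_disk xy -> rc (u xy) = rc 2^-1 * F (of_plane xy) + conjc (rc 2^-1 * F (of_plane xy)).
  by move=> /uE ->; rewrite half_conj.
have P xy : plane_disk xy -> [/\ derivable u xy (e_x R), derivable u xy (e_y R),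
    'D_(e_x R) u xy = complex.Re (F^`() (of_plane xy)) &
    'D_(e_y R) u xy = complex.Re ('i%C * derive1 F (of_plane xy))].
  move=> xyD; have d2 := hderivZ (rc 2^-1) (dF _ xyD).
  have [d3 d4 Ex Ey] := partials_of_decomposition xyD uE' d2 d2.
  split=> //; first by move: Ex; rewrite half_conj => -[].
  by move: Ey; rewrite mulrCA half_conj => -[].
have near_eq (f g : R * R -> R) xy : plane_disk xy ->
    (forall xy, plane_disk xy -> f xy = g xy) ->
    {for xy, continuous g} -> {for xy, continuous f}.
  move=> xyD fg cg.
  have N : \forall x \near xy, g x = f x.
    have : nbhs xy (plane_disk (R := R)).
      have op : open (plane_disk (R := R)).
        rewrite /plane_disk (_ : _ @^-1` _ = (fun xy => cabs (of_plane xy)) @^-1` [set x | x < 1])//.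
        by apply: open_comp; [move=> ? _; exact: continuous_cabs_plane|exact: open_lt].
      exact: open_nbhs_nbhs.
    by apply: filterS => x /fg.
  have -> : {for xy, continuous f} = (f x @[x --> xy] --> g xy) by rewrite -fg.
  by apply: cvg_trans cg; apply: near_eq_cvg.
have Px xy (xyD : plane_disk xy) : 'D_(e_x R) u xy = complex.Re (F^`() (of_plane xy)).
  by have [_ _ ->] := P xy xyD.
have Py xy (xyD : plane_disk xy) :
    'D_(e_y R) u xy = complex.Re ('i%C * derive1 F (of_plane xy)).
  by have [_ _ _ ->] := P xy xyD.
split => [xy xyD||]; [|exact: Px|exact: Py].
have [d1 d2 _ _] := P xy xyD; split; [|exact: d1|exact: d2| |].
- by apply: (near_eq _ _ _ xyD uE); apply: ccont_plane; exact: holo_cont hF xyD.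
- apply: (near_eq _ _ _ xyD Px).
  by apply: ccont_plane; exact: cF.
- apply: (near_eq _ _ _ xyD Py).
  apply: (@ccont_plane (fun z => 'i%C * derive1 F z)).
  by apply: hcontM (hcont_cst idfun _ _) _; exact: cF.
Qed.

Lemma hol_real_harmonic (F : C -> C^o) : hol (disk (R := R)) F ->
  real_harmonic (fun xy => complex.Re (F (of_plane xy))).
Proof.
move=> hF; have hF' := hol_derive copen_disk hF.
have [hiF' iF'E] := holo_hol copen_disk (holoZ 'i%C hF' : holo _ (fun z => 'i%C * derive1 F z : C^o) _).
have [c0 Dx Dy] := hol_real_part hF (fun xy _ => erefl).
have [cx Dxx _] := hol_real_part hF' Dx.
have [cy _ Dyy] := hol_real_part hiF' Dy.
split; first by split.
move=> xy xyD; rewrite /laplacian Dxx// Dyy// iF'E//.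
by rewrite mulrA -expr2 sqr_i mulN1r ReN subrr.
Qed.

End Plane.

(** * Harmonic conjugation *)

Section Conjugation.
Context {R : realType}.
Local Notation C := R[i].
Local Notation rc := (real_complex R).
Implicit Types (n : nat) (p alpha B : R) (f h g : C -> C^o).

Lemma area_integral_of_Qh n p alpha h g : (Qh_norm_pow n p alpha h g < +oo)%E ->
  exists M : R, forall a, disk a -> (area_integral (fun z =>
    ((cabs (derive1n n (h \o sigma a) z) + cabs (derive1n n (g \o sigma a) z)) `^ p
       * (1 - cabs z ^+ 2) `^ alpha)%R) <= M%:E)%E.
Proof.
rewrite /Qh_norm_pow; set S := [set _ | _ in _].
have ub a : disk a -> (area_integral (fun z =>
    ((cabs (derive1n n (h \o sigma a) z) + cabs (derive1n n (g \o sigma a) z)) `^ p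
       * (1 - cabs z ^+ 2) `^ alpha)%R) <= ereal_sup S)%E.
  by move=> aD; apply: ereal_sup_ubound; exists a.
move: ub; case: (ereal_sup S) => [r| |] ub // _; first by exists r.
by exists 0 => a aD; apply: le_trans (ub a aD) _; exact: leNye.
Qed.

(** The [n]th derivatives of all the [h o sigma_a] at the origin are bounded by
   their area means, hence [h] is Bloch. *)
Lemma bloch_of_Qh n p alpha h g : 0 < p -> hol (disk (R := R)) h ->
  (Qh_norm_pow n.+1 p alpha h g < +oo)%E ->
  exists B, forall a, disk a -> (1 - cabs a ^+ 2) * cabs (h^`() a) <= B.
Proof.
move=> p0 hh /area_integral_of_Qh[M HM].
have [B HB] := value0_le_of_area_integral alpha M p0.
apply: (bloch_of_derivn (n := n) (M := B) hh) => a aD.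
have [ha _] := hol_comp_sigma aD hh.
apply: (HB _ _ (hol_derivn n.+1 copen_disk ha) _ (HM a aD)) => z _.
by rewrite lerDl cabs_ge0.
Qed.

(** By [cabs_sigma'] the Bloch seminorm is invariant under automorphisms; the
   weight [1 - |z|] is the one on which Cauchy's estimate can be iterated. *)
Lemma bloch_comp_sigma h B a : hol (disk (R := R)) h -> disk a ->
  (forall a, disk a -> (1 - cabs a ^+ 2) * cabs (h^`() a) <= B) ->
  forall z, disk z -> (1 - cabs z) * cabs ((h \o sigma a)^`() z) <= B.
Proof.
move=> hh aD hB z zD; have [_ ->//] := hol_comp_sigma aD hh.
apply: le_trans (hB _ (disk_sigma aD zD)).
rewrite -cabs_sigma'// cabsM mulrA ler_wpM2r ?cabs_ge0// ler_wpM2r ?cabs_ge0//.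
have c1 : cabs z <= 1 by exact: ltW.
by rewrite lerD2l lerN2 expr2 ler_piMl ?cabs_ge0.
Qed.

Lemma Qh_of_bloch n p alpha h g B : 0 < p -> n.+1%:R * p - 1 < alpha ->
  hol (disk (R := R)) h -> hol (disk (R := R)) g ->
  (forall a, disk a -> (1 - cabs a ^+ 2) * cabs (h^`() a) <= B) ->
  (forall a, disk a -> (1 - cabs a ^+ 2) * cabs (g^`() a) <= B) ->
  (Qh_norm_pow n.+1 p alpha h g < +oo)%E.
Proof.
move=> p0 pa hh hg hB gB; have [c Hc] := derivn_growth (R := R) n.
pose A := c * B + c * B.
have key a z : disk a -> disk z -> (1 - cabs z) ^+ n.+1 *
    (cabs (derive1n n.+1 (h \o sigma a) z) + cabs (derive1n n.+1 (g \o sigma a) z)) <= A.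
  move=> aD zD; rewrite mulrDr lerD//.
    have [ha _] := hol_comp_sigma aD hh.
    by apply: Hc ha _ _ zD; exact: bloch_comp_sigma hh aD hB.
  have [ga _] := hol_comp_sigma aD hg.
  by apply: Hc ga _ _ zD; exact: bloch_comp_sigma hg aD gB.
have A0 : 0 <= A.
  apply: le_trans (key _ _ (@disk0 R) (@disk0 R)).
  by rewrite cabs0 subr0 expr1n mul1r addr_ge0 ?cabs_ge0.
have [M HM] := area_integral_growth p0 pa A0.
apply: (@le_lt_trans _ _ M%:E); last exact: ltry.
apply: ge_ereal_sup => _ [a aD <-]; apply: HM => z zD.
  by rewrite addr_ge0 ?cabs_ge0.
exact: key.
Qed.

Lemma hol_analytic f : hol (disk (R := R)) f -> analytic f.
Proof. by move=> hf z zD; exact: cderiv_derivable (hol_cderiv hf zD). Qed.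

Lemma hol0 : hol (disk (R := R)) (fun=> 0 : C^o).
Proof. exact: (holo_hol copen_disk (holo_cst (disk (R := R)) 0)).1. Qed.

Lemma im_part_harmonic f :
  real_harmonic (fun xy => complex.Im (f (of_plane xy))) -> harmonic_fun (im_part f).
Proof. by move=> hf; split; [exact: hf|exact: (hol_real_harmonic hol0)]. Qed.

(** A pointwise bound of [q'] by [h'] transports the Bloch condition, although it
   says nothing about the derivatives of higher order that define the norms. *)
Lemma Qh_im_part n p alpha f h g q kappa : 0 < p -> n.+1%:R * p - 1 < alpha ->
  hol (disk (R := R)) h -> hol (disk (R := R)) q ->
  (Qh_norm_pow n.+1 p alpha h g < +oo)%E ->
  (forall z, disk z -> rc (complex.Im (f z)) = q z + conjc (q z)) ->
  0 <= kappa ->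
  (forall z, disk z -> cabs (q^`() z) <= kappa * cabs (h^`() z)) ->
  harmonic_fun (im_part f) -> Qh n.+1 p alpha (im_part f).
Proof.
move=> p0 pa hh hq hQ fq k0 qh hf; split=> //.
have [B HB] := bloch_of_Qh p0 hh hQ.
have qB a : disk a -> (1 - cabs a ^+ 2) * cabs (q^`() a) <= kappa * B.
  move=> aD; have a0 : 0 <= 1 - cabs a ^+ 2.
    by move: (aD); rewrite disk_sqr subr_ge0 => /ltW.
  rewrite (le_trans (ler_wpM2l a0 (qh a aD)))// mulrCA ler_wpM2l//.
  exact: HB.
have shift c : hol (disk (R := R)) (fun z => q z + c : C^o) /\
    forall z, disk z -> (fun z => q z + c : C^o)^`() z = q^`() z.
  have [h1 E] := holo_hol copen_disk (holoD hq (holo_cst _ c) : holo _ (fun z => q z + c : C^o) _).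
  by split; [exact: h1|move=> z zD; rewrite (E z zD) addr0].
have [h1 E1] := shift (conjc (q 0)); have [h2 E2] := shift (- q 0).
exists (fun z => q z + conjc (q 0)), (fun z => q z + - q 0); split.
  split; [exact: hol_analytic|exact: hol_analytic|exact: subrr|].
  move=> z zD; rewrite /im_part fq//.
  transitivity (q z + conjc (q 0) + conjc (q z - q 0)); last by [].
  have I (x y u : C) : x + y = x + u + (y - u) by ring.
  by rewrite (rmorphB conjc); exact: I.
apply: (Qh_of_bloch p0 pa h1 h2 (B := kappa * B)) => a aD.
- by rewrite (E1 a aD); exact: qB.
- by rewrite (E2 a aD); exact: qB.
Qed.

Lemma real_harmonic_C1 u : real_harmonic (R := R) u -> C1_disk u.
Proof. by move=> [[]]. Qed.

(** Both derivatives are the same Wirtinger derivative of [u]. *)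
Lemma derive_decomposition_unique (u : R * R -> R) (a b c d : C -> C^o) z : disk z ->
  (forall xy, plane_disk xy -> rc (u xy) = a (of_plane xy) + conjc (b (of_plane xy))) ->
  (forall xy, plane_disk xy -> rc (u xy) = c (of_plane xy) + conjc (d (of_plane xy))) ->
  analytic a -> analytic b -> analytic c -> analytic d -> a^`() z = c^`() z.
Proof.
move=> zD E1 E2 aa ab ac ad.
have xyD : plane_disk (complex.Re z, complex.Im z) by rewrite /plane_disk/= of_planeK.
have D f : analytic f -> cderiv f (of_plane (complex.Re z, complex.Im z)) (f^`() z).
  by move=> af; rewrite of_planeK; exact: derivable_cderiv (af z zD).
by rewrite (wirtinger xyD E1 (D a aa) (D b ab)) (wirtinger xyD E2 (D c ac) (D d ad)).
Qed.

Lemma analytic_lin (c d : C) f g : analytic f -> analytic g ->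
  analytic (fun z => c * f z + d * g z : C^o) /\
  forall z, disk z -> (fun z => c * f z + d * g z : C^o)^`() z =
    c * derive1 f z + d * derive1 g z.
Proof.
move=> af ag.
have D z : disk z -> cderiv (fun z => c * f z + d * g z) z (c * derive1 f z + d * derive1 g z).
  move=> zD; apply: (@hderivD _ _ idfun); apply: (@hderivZ _ _ idfun).
    exact: derivable_cderiv (af z zD).
  exact: derivable_cderiv (ag z zD).
split=> z zD; first exact: cderiv_derivable (D z zD).
exact: cderiv_derive1 (D z zD).
Qed.

Lemma conj_half_sum (a b : C) :
  rc (complex.Re (a + conjc b)) = rc 2^-1 * a + rc 2^-1 * b + conjc (rc 2^-1 * a + rc 2^-1 * b).
Proof.
case: a b => [a1 a2] [b1 b2]; apply/eqP; rewrite eq_complex/=.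
by apply/andP; split; apply/eqP; field.
Qed.

Lemma conj_half_diff (a b c : C) : c = - ('i%C * rc 2^-1) ->
  rc (complex.Im (a + conjc b)) = c * a + - c * b + conjc (c * a + - c * b).
Proof.
move=> ->; case: a b => [a1 a2] [b1 b2]; apply/eqP; rewrite eq_complex/=.
by apply/andP; split; apply/eqP; field.
Qed.

(** With [k = (K - 1) / (K + 1)] the comparison constant [(1 + k) / (1 - k)] is
   [K]. *)
Lemma dilatation_le (K : R) (a b : C) : 1 <= K ->
  cabs b <= (K - 1) / (K + 1) * cabs a -> cabs (a - b) <= K * cabs (a + b).
Proof.
move=> K1; have K0 : 0 < K + 1 by rewrite ltr_wpDl// (le_trans ler01).
rewrite mulrAC ler_pdivlMr// => H.
have h1 := cabsD a (- b); rewrite cabsN in h1.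
have h2 := cabsD (a + b) (- b); rewrite addrK cabsN in h2.
have Kp : 0 <= K by rewrite (le_trans ler01).
have h3 : K * (cabs a - cabs b) <= K * cabs (a + b).
  by rewrite ler_wpM2l// lerBlDr.
rewrite (le_trans h1)// (le_trans _ h3)//.
by move: H; move: (cabs a) (cabs b) => x y; clear; nra.
Qed.

End Conjugation.

Unset Implicit Arguments.
Set Strict Implicit.
Set Printing Implicit Defensive.

Theorem theorem2p1 (R : realType) (n : nat) (p alpha : R) :
  (1 <= n)%N -> 0 < p -> n%:R * p - 1 < alpha ->
  (forall (K : R) (f : R[i] -> R[i]^o), 1 <= K -> quasiregular K f ->
     Qh n p alpha (re_part f) -> Qh n p alpha (im_part f)) /\
  (forall f : R[i] -> R[i]^o, analytic f ->
     Qh n p alpha (re_part f) -> Qh n p alpha (im_part f)).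
Proof.
case: n => // n _ p0 pa.
pose c : R[i] := - ('i%C * (2^-1)%:C%C).
have cc : cabs c = 2^-1.
  by rewrite cabsN cabsM cabs_i mul1r cabs_rc ger0_norm// invr_ge0.
split=> [K f K1 [[hre him] [h [g [[ah ag g0 fE] _ hgK]]]] [_ [H [G [[aH aG G0 HE] HQ]]]]|
         f af [[hre _] [H [G [[aH aG G0 HE] HQ]]]]].
- have reE xy : plane_disk xy -> (complex.Re (f (of_plane xy)))%:C%C =
      H (of_plane xy) + conjc (G (of_plane xy)) by exact: HE.
  have hH := hol_of_C1_decomposition (real_harmonic_C1 hre) reE aH aG.
  have [aS dS] := analytic_lin (2^-1)%:C%C (2^-1)%:C%C ah ag.
  have [aq dq] := analytic_lin c (- c) ah ag.
  have imE z : disk z -> (complex.Im (f z))%:C%C =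
      (c * h z + - c * g z) + conjc (c * h z + - c * g z).
    by move=> zD; rewrite fE//; exact: conj_half_diff.
  have imE' xy : plane_disk xy -> (complex.Im (f (of_plane xy)))%:C%C =
      (c * h (of_plane xy) + - c * g (of_plane xy))
      + conjc (c * h (of_plane xy) + - c * g (of_plane xy)) by exact: imE.
  have hq := hol_of_C1_decomposition (real_harmonic_C1 him) imE' aq aq.
  have reE' xy : plane_disk xy -> (complex.Re (f (of_plane xy)))%:C%C =
      ((2^-1)%:C%C * h (of_plane xy) + (2^-1)%:C%C * g (of_plane xy))
      + conjc ((2^-1)%:C%C * h (of_plane xy) + (2^-1)%:C%C * g (of_plane xy)).
    by move=> xyD; rewrite fE//; exact: conj_half_sum.
  apply: (Qh_im_part p0 pa hH hq HQ imE (le_trans ler01 K1)); last exact: im_part_harmonic.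
  move=> z zD.
  rewrite (derive_decomposition_unique zD reE reE' aH aG aS aS) dS// dq//.
  have I (e x y : R[i]) : e * x + - e * y = e * (x - y) by ring.
  rewrite I -mulrDr !cabsM cc cabs_rc ger0_norm ?invr_ge0// mulrCA ler_wpM2l ?invr_ge0//.
  by apply: dilatation_le => //; exact: hgK.
have reE xy : plane_disk xy -> (complex.Re (f (of_plane xy)))%:C%C =
    H (of_plane xy) + conjc (G (of_plane xy)) by exact: HE.
have hH := hol_of_C1_decomposition (real_harmonic_C1 hre) reE aH aG.
have [aS dS] := analytic_lin (2^-1)%:C%C 0 af af.
have hS xy : plane_disk xy -> (complex.Re (f (of_plane xy)))%:C%C =
    ((2^-1)%:C%C * f (of_plane xy) + 0 * f (of_plane xy))
    + conjc ((2^-1)%:C%C * f (of_plane xy) + 0 * f (of_plane xy)).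
  by move=> _; rewrite mul0r addr0 half_conj.
have hhalf := hol_of_C1_decomposition (real_harmonic_C1 hre) hS aS aS.
have hf : hol (disk (R := R)) f.
  have [] // := hol_eq copen_disk
    ((holo_hol copen_disk (holoZ (2%:R)%:C%C hhalf : holo _ (fun z => _ : R[i]^o) _)).1) (f := f).
  by move=> z zD; rewrite mul0r addr0 mulrA -rmorphM divff ?rmorph1 ?mul1r ?pnatr_eq0.
have hq : hol (disk (R := R)) (fun z => c * f z : R[i]^o) /\ forall z, disk z ->
    (fun z => c * f z : R[i]^o)^`() z = c * derive1 f z.
  exact: (holo_hol copen_disk (holoZ c hf : holo _ (fun z => c * f z : R[i]^o) _)).
have imE z : disk z -> (complex.Im (f z))%:C%C = c * f z + conjc (c * f z).
  by move=> _; have := conj_half_diff (f z) 0 (erefl c); rewrite conjc0 addr0 mulr0 addr0.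
apply: (Qh_im_part p0 pa hH hq.1 HQ imE ler01).
  move=> z zD; rewrite mul1r (derive_decomposition_unique zD reE hS aH aG aS aS) dS//.
  by rewrite hq.2// mul0r addr0 !cabsM cc cabs_rc ger0_norm ?invr_ge0.
apply: im_part_harmonic.
have [hif _] := holo_hol copen_disk (holoZ (- 'i%C) hf : holo _ (fun z => - 'i%C * f z : R[i]^o) _).
have := hol_real_harmonic hif; congr real_harmonic.
by apply/funext => xy; case: (f _) => a b /=; ring.
Qed.
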